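(* Let $\mathcal{T}$ be a weakly bilinear mapping theory in which all mapping spaces $\mathcal{T}(A,B)$ are Serre cofibrant. Let $n \geq 1$, and let $\varphi^{n-1}$ be a good $(n-1)$-distributor for $\mathcal{T}$. Then there exists a good $n$-distributor $\varphi^n$ for $\mathcal{T}$ based on $\varphi^{n-1}$. Moreover, such a $\varphi^n$ is unique up to homotopy rel $\partial I^n$; that is, for any two good $n$-distributors based on $\varphi^{n-1}$ and all objects $X,A,B$ of $\mathcal{T}$, the two corresponding continuous maps $I^n \times \mathcal{T}(A,B) \times \mathcal{T}(X,A)^{n+1} \to \mathcal{T}(X,B)$ are homotopic relative to $\partial I^n \times \mathcal{T}(A,B) \times \mathcal{T}(X,A)^{n+1}$.
   Context: $\mathbf{Top}$ is a convenient category of topological spaces (e.g. compactly generated weakly Hausdorff spaces), $\mathbf{Top}_*$ its pointed version with basepoints denoted $0$. A $\mathbf{Top}_*$-category $\mathcal{C}$ is a category enriched in $\mathbf{Top}_*$ with respect to the smash product; equivalently composition $\mathcal{C}(B,C)\times\mathcal{C}(A,B)\to\mathcal{C}(A,C)$, $(x,y)\mapsto xy$, is continuous with $0y=0$ and $x0=0$. We write $x\in\mathcal{C}$ for a morphism $x$; in expressions, morphisms are assumed composable/addable. A space is Serre cofibrant if it is cofibrant in the Serre (Quillen) model structure on $\mathbf{Top}$. A $\mathbf{Top}_*$-category $\mathcal{T}$ is a mapping theory if it is small and has finite products. It is left linear if all mapping spaces $\mathcal{T}(A,B)$ are topological monoids (written additively, not assumed commutative) with the basepoint $0$ as identity, and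 $(x+x')y=xy+x'y$. A mapping theory is weakly bilinear if it is left linear and, for all objects $A,B,Z$, the map $(i_A^*,i_B^* )\colon\mathcal{T}(A\times B,Z)\to\mathcal{T}(A,Z)\times\mathcal{T}(B,Z)$ is a Serre fibration and a weak equivalence, where $i_A=(1_A,0)$ and $i_B=(0,1_B)$. With $I=[0,1]$, an $n$-cube in a space $Y$ is a map $I^n\to Y$. External addition of cubes $u\colon I^m\to Y$, $v\colon I^k\to Y$ in a topological monoid $Y$ is the $(m+k)$-cube $(u\oplus v)(s,t)=u(s)+v(t)$. For a cube $u\colon I^m\to\mathcal{T}(A,B)$ and a morphism $x\in\mathcal{T}(X,A)$, $u\otimes x$ is the cube $t\mapsto u(t)x$. Let $\mathcal{T}$ be left linear. An $n$-distributor for $\mathcal{T}$ consists of collections $\varphi^0,\dots,\varphi^n$, where $\varphi^m$ assigns to all $a\in\mathcal{T}(A,B)$, $x_0,\dots,x_m\in\mathcal{T}(X,A)$ an $m$-cube $\varphi_a^{x_0,\dots,x_m}\colon I^m\to\mathcal{T}(X,B)$, continuous in the inputs (i.e. $\mathcal{T}(A,B)\times\mathcal{T}(X,A)^{m+1}\to\mathcal{T}(X,B)^{I^m}$ is continuous), such that $\varphi_a^x=ax$ and for $1\le m\le n$, $1\le j\le m$: $$\varphi_a^{x_0,\dots,x_m}(t_1,\dots,t_m)=\begin{cases}\varphi_a^{x_0,\dots,x_{j-1}+x_j,\dots,x_m}(t_1,\dots,\widehat{t_j},\dots,t_m)&\text{if }t_j=0\\ \varphi_a^{x_0,\dots,x_{j-1}}(t_1,\dots,t_{j-1})+\varphi_a^{x_j,\dots,x_m}(t_{j+1},\dots,t_m)&\text{if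 }t_j=1.\end{cases}$$ It is denoted by its top part $\varphi^n$ (which determines the lower $\varphi^m$) and is said to be based on the $(n-1)$-distributor $\varphi^{n-1}$. An $n$-distributor $\varphi^n$ is good if: (Universality) for all $a\colon A\to B$ and $x_0,\dots,x_n\colon X\to A$, $\varphi_a^{x_0,\dots,x_n}=\varphi_a^{p_0,\dots,p_n}\otimes(x_0,\dots,x_n)$, where $p_0,\dots,p_n\colon A^{n+1}\to A$ are the projections; and (Wedge condition) for all $a\colon A\to B$, $x\colon X\to A$ and $0\le k\le n$, the cube $\varphi_a^{0,\dots,x,\dots,0}$ ($x$ in position $k$) is the constant $n$-cube at $ax$. *)

(* Defs.v *)
From HB Require Import structures.
From mathcomp Require Import all_boot all_order all_algebra.
From mathcomp Require Import all_classical all_reals all_analysis.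

Set Implicit Arguments.
Unset Strict Implicit.
Unset Printing Implicit Defensive.

Import Order.TTheory GRing.Theory Num.Theory.
Local Open Scope classical_set_scope.
Local Open Scope ring_scope.

(** The convenient category [Top] is that of compactly generated weakly
    Hausdorff (CGWH) spaces. *)

Definition kopen (X : topologicalType) (U : set X) : Prop :=
  forall (K : topologicalType) (u : K -> X),
    compact [set: K] -> hausdorff_space K -> continuous u ->
    open (u @^-1` U).

(* [kify X] is the set X with its k-ified topology. Products in [Top] are
   k-ifications of the product topology: [kify (X * Y)] is the product of X and
   Y in [Top], and [kify {ptws 'I_n -> X}] is the n-th power of X. *)
Definition kify (X : topologicalType) : Type := X.

HB.instance Definition _ (X : topologicalType) := Choice.on (kify X).

Section kify_topology.
Context {X : topologicalType}.

Let kopenT : @kopen X setT.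
Proof. by move=> K u _ _ _; rewrite preimage_setT; exact: openT. Qed.

Let kopenI : setI_closed (@kopen X).
Proof.
move=> U V oU oV K u cK hK cu; rewrite preimage_setI.
by apply: openI; [exact: oU | exact: oV].
Qed.

Let kopen_bigU (I : Type) (f : I -> set X) :
  (forall i, kopen (f i)) -> kopen (\bigcup_i f i).
Proof.
move=> of_ K u cK hK cu; rewrite preimage_bigcup.
by apply: bigcup_open => i _; exact: of_.
Qed.

HB.instance Definition _ :=
  isOpenTopological.Build (kify X) kopenT kopenI kopen_bigU.
End kify_topology.

Definition compactly_generated (X : topologicalType) : Prop :=
  forall U : set X, kopen U -> open U.

Definition weakly_hausdorff (X : topologicalType) : Prop :=
  forall (K : topologicalType) (u : K -> X),
    compact [set: K] -> hausdorff_space K -> continuous u ->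
    closed (range u).

Definition cgwh (X : topologicalType) : Prop :=
  compactly_generated X /\ weakly_hausdorff X.

Section Interval.
Variable R : realType.

Definition unit_interval : topologicalType := set_type `[0, 1 : R].

Fact in01_0 : (0 : R) \in `[0, 1]%classic.
Proof. by rewrite inE /= in_itv /= lexx ler01. Qed.

Fact in01_1 : (1 : R) \in `[0, 1]%classic.
Proof. by rewrite inE /= in_itv /= ler01 lexx. Qed.

Definition i0 : unit_interval := SigSub in01_0.
Definition i1 : unit_interval := SigSub in01_1.

Definition cube (n : nat) : topologicalType := {ptws 'I_n -> unit_interval}.

Definition cube_boundary (n : nat) : set (cube n) :=
  [set t | exists j, t j = i0 \/ t j = i1].

Definition homotopic_rel (X Y : topologicalType) (D : set X) (f g : X -> Y) :=
  exists H : kify (unit_interval * X)%type -> Y,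
    [/\ continuous H,
        forall p, H (i0, p) = f p,
        forall p, H (i1, p) = g p &
        forall s p, D p -> H (s, p) = f p].

Definition joined (X : topologicalType) (x y : X) : Prop :=
  exists c : unit_interval -> X, [/\ continuous c, c i0 = x & c i1 = y].

Definition spheroid (X : topologicalType) (n : nat) (x : X) (g : cube n -> X) :=
  continuous g /\ forall t, cube_boundary t -> g t = x.

(* The map pi_n(X, x) -> pi_n(Y, f x) induced by f is bijective, where pi_n is
   the set of homotopy classes rel boundary of maps (I^n, boundary) -> (X, x).
   For n > 0 this map is a group homomorphism. *)
Definition pi_bijective (X Y : topologicalType) (f : X -> Y) (n : nat) (x : X) :=
  (forall h h' : cube n -> X, spheroid x h -> spheroid x h' ->
     homotopic_rel (@cube_boundary n) (f \o h) (f \o h') ->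
     homotopic_rel (@cube_boundary n) h h') /\
  (forall g : cube n -> Y, spheroid (f x) g ->
     exists2 h : cube n -> X, spheroid x h &
       homotopic_rel (@cube_boundary n) (f \o h) g).

Definition pi0_bijective (X Y : topologicalType) (f : X -> Y) :=
  (forall x x', joined (f x) (f x') -> joined x x') /\
  (forall y, exists x, joined (f x) y).

Definition weak_equivalence (X Y : topologicalType) (f : X -> Y) : Prop :=
  [/\ continuous f, pi0_bijective f &
      forall (n : nat) (x : X), (0 < n)%N -> pi_bijective f n x].

Definition serre_fibration (E B : topologicalType) (p : E -> B) : Prop :=
  continuous p /\
  forall (n : nat) (g : cube n -> E) (h : (cube n * unit_interval)%type -> B),
    continuous g -> continuous h -> (forall t, h (t, i0) = p (g t)) ->
    exists k : (cube n * unit_interval)%type -> E,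
      [/\ continuous k, forall t, k (t, i0) = g t & forall z, p (k z) = h z].

(* Cofibrant in the Serre model structure: the map from the empty space to X has
   the left lifting property with respect to the trivial Serre fibrations of
   [Top]. The square for such a lifting problem is just a map f : X -> B. *)
Definition serre_cofibrant (X : topologicalType) : Prop :=
  forall (E B : topologicalType) (p : E -> B),
    cgwh E -> cgwh B -> serre_fibration p -> weak_equivalence p ->
    forall f : X -> B, continuous f ->
    exists2 g : X -> E, continuous g & forall x, p (g x) = f x.

End Interval.

(* A small category enriched in pointed CGWH spaces; the basepoint 0 of a
   mapping space is its [point]. *)
Record topPtCat := TopPtCat {
  obj :> Type;
  mapsp : obj -> obj -> ptopologicalType;
  mapsp_cgwh : forall A B, cgwh (mapsp A B);
  idm : forall A, mapsp A A;
  cmp : forall A B C, mapsp B C -> mapsp A B -> mapsp A C;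
  cmp_continuous : forall A B C,
    continuous (fun z : kify (mapsp B C * mapsp A B)%type => cmp z.1 z.2);
  cmpA : forall A B C D (x : mapsp C D) (y : mapsp B C) (z : mapsp A B),
    cmp x (cmp y z) = cmp (cmp x y) z;
  cmp1m : forall A B (x : mapsp A B), cmp (idm B) x = x;
  cmpm1 : forall A B (x : mapsp A B), cmp x (idm A) = x;
  cmp0m : forall A B C (y : mapsp A B), cmp (point : mapsp B C) y = point;
  cmpm0 : forall A B C (x : mapsp B C), cmp x (point : mapsp A B) = point
}.

Arguments idm {_} _.
Arguments cmp {_ _ _ _} _ _.

(* Finite products are products in the enriched sense: the bijection
   T(X, prod_j A_j) -> prod_j T(X, A_j) is a homeomorphism. The continuity of
   the map from left to right follows from that of [cmp]. *)
Record mappingTheory := MappingTheory {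
  mt_cat :> topPtCat;
  fprod : forall J : finType, (J -> mt_cat) -> mt_cat;
  fproj : forall (J : finType) (A : J -> mt_cat) (j : J), mapsp (fprod A) (A j);
  pairing : forall (J : finType) (A : J -> mt_cat) (X : mt_cat),
    (forall j, mapsp X (A j)) -> mapsp X (fprod A);
  fproj_pairing : forall (J : finType) (A : J -> mt_cat) (X : mt_cat)
    (x : forall j, mapsp X (A j)) (j : J), cmp (fproj A j) (pairing x) = x j;
  pairing_fproj : forall (J : finType) (A : J -> mt_cat) (X : mt_cat)
    (y : mapsp X (fprod A)), pairing (fun j => cmp (fproj A j) y) = y;
  pairing_continuous : forall (J : finType) (A : J -> mt_cat) (X : mt_cat),
    continuous (fun x : kify (prod_topology (fun j => mapsp X (A j))) =>
                  @pairing J A X x)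
}.

Arguments fprod {_ _} _.
Arguments fproj {_ _} _ _.
Arguments pairing {_ _} _ {_} _.

Record leftLinearTheory := LeftLinearTheory {
  ll_theory :> mappingTheory;
  madd : forall A B : ll_theory, mapsp A B -> mapsp A B -> mapsp A B;
  madd_continuous : forall A B : ll_theory,
    continuous (fun z : kify (mapsp A B * mapsp A B)%type => madd z.1 z.2);
  maddA : forall (A B : ll_theory) (x y z : mapsp A B),
    madd x (madd y z) = madd (madd x y) z;
  madd0m : forall (A B : ll_theory) (x : mapsp A B), madd point x = x;
  maddm0 : forall (A B : ll_theory) (x : mapsp A B), madd x point = x;
  cmpDl : forall (A B C : ll_theory) (x x' : mapsp B C) (y : mapsp A B),
    cmp (madd x x') y = madd (cmp x y) (cmp x' y)
}.

Arguments madd {_ _ _} _ _.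

Section BinaryProduct.
Variables (T : mappingTheory) (A B : T).

Definition binprod : T := fprod (fun b : bool => if b then A else B).

Definition incl_l : mapsp A binprod :=
  pairing (fun b : bool => if b then A else B)
    (fun b => if b return mapsp A (if b then A else B) then idm A else point).

Definition incl_r : mapsp B binprod :=
  pairing (fun b : bool => if b then A else B)
    (fun b => if b return mapsp B (if b then A else B) then point else idm B).

Definition restrict (Z : T) (f : mapsp binprod Z) :
    kify (mapsp A Z * mapsp B Z)%type :=
  (cmp f incl_l, cmp f incl_r).

End BinaryProduct.

Definition weakly_bilinear (R : realType) (T : leftLinearTheory) : Prop :=
  forall A B Z : T,
    serre_fibration R (@restrict T A B Z) /\
    weak_equivalence R (@restrict T A B Z).

(* (x_0, ..., x_{j-1} + x_j, ..., x_{m+1}) for 1 <= j <= m+1, with j stored as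
   the ordinal j-1. *)
Definition add_adjacent (T : leftLinearTheory) (X A : T) (m : nat)
    (x : 'I_m.+2 -> mapsp X A) (j : 'I_m.+1) : 'I_m.+1 -> mapsp X A :=
  fun i => if (i < j)%N then x (inord i)
           else if i == j then madd (x (inord i)) (x (inord i.+1))
           else x (inord i.+1).

(* [dist phi m a x t] is phi_a^{x_0, ..., x_m}(t_1, ..., t_m). The family is
   indexed by all m : nat for convenience, but only the members with m <= n are
   constrained; the others are irrelevant. Coordinates of cubes are numbered
   from 0, so that the face t_j of the mathematical definition is the ordinal
   j-1 here. All uses of [inord] are in range.
   In [dist_continuous], k-ifying the function space would change nothing since
   the domain is compactly generated. *)
Record distributor (R : realType) (T : leftLinearTheory) (n : nat) :=
  Distributor {
  dist : forall (m : nat) (A B X : T),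
    mapsp A B -> ('I_m.+1 -> mapsp X A) -> cube R m -> mapsp X B;
  dist_cube : forall (m : nat) (A B X : T)
    (a : mapsp A B) (x : 'I_m.+1 -> mapsp X A),
    (m <= n)%N -> continuous (dist a x);
  dist_continuous : forall (m : nat) (A B X : T),
    (m <= n)%N ->
    continuous (fun z : kify (mapsp A B * {ptws 'I_m.+1 -> mapsp X A})%type =>
                  dist z.1 z.2 : {compact-open, cube R m -> mapsp X B});
  dist_base : forall (A B X : T) (a : mapsp A B) (x : 'I_1 -> mapsp X A)
    (t : cube R 0), dist a x t = cmp a (x ord0);
  dist_face0 : forall (m : nat) (A B X : T)
    (a : mapsp A B) (x : 'I_m.+2 -> mapsp X A) (j : 'I_m.+1) (t : cube R m.+1),
    (m.+1 <= n)%N -> t j = i0 R ->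
    dist a x t = dist a (add_adjacent x j) (fun i : 'I_m => t (lift j i));
  dist_face1 : forall (m : nat) (A B X : T)
    (a : mapsp A B) (x : 'I_m.+2 -> mapsp X A) (j : 'I_m.+1) (t : cube R m.+1),
    (m.+1 <= n)%N -> t j = i1 R ->
    dist a x t =
      madd (dist a (fun i : 'I_j.+1 => x (inord i))
                   (fun i : 'I_j => t (inord i)))
           (dist a (fun i : 'I_(m - j).+1 => x (inord (j.+1 + i)%N))
                   (fun i : 'I_(m - j) => t (inord (j.+1 + i)%N)))
}.

Arguments dist {R T n} _ m {A B X} _ _ _.

Definition based_on (R : realType) (T : leftLinearTheory) (n : nat)
    (phi : distributor R T n) (psi : distributor R T n.-1) : Prop :=
  forall (m : nat) (A B X : T) (a : mapsp A B) (x : 'I_m.+1 -> mapsp X A)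
    (t : cube R m),
    (m <= n.-1)%N -> dist phi m a x t = dist psi m a x t.

Definition universal (R : realType) (T : leftLinearTheory) (n : nat)
    (phi : distributor R T n) : Prop :=
  forall (A B X : T) (a : mapsp A B) (x : 'I_n.+1 -> mapsp X A) (t : cube R n),
    dist phi n a x t =
    cmp (dist phi n a (fproj (fun _ : 'I_n.+1 => A)) t)
        (pairing (fun _ : 'I_n.+1 => A) x).

Definition wedge_condition (R : realType) (T : leftLinearTheory) (n : nat)
    (phi : distributor R T n) : Prop :=
  forall (A B X : T) (a : mapsp A B) (x : mapsp X A) (k : 'I_n.+1) (t : cube R n),
    dist phi n a (fun i => if i == k then x else point) t = cmp a x.

Definition good (R : realType) (T : leftLinearTheory) (n : nat)
    (phi : distributor R T n) : Prop :=
  universal phi /\ wedge_condition phi.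

Section TopMap.
Variables (R : realType) (T : leftLinearTheory) (n : nat) (X A B : T).

(* I^n x T(A,B) x T(X,A)^{n+1} *)
Definition top_domain : topologicalType :=
  kify (cube R n * mapsp A B * {ptws 'I_n.+1 -> mapsp X A})%type.

Definition top_boundary : set top_domain :=
  [set z : top_domain | cube_boundary z.1.1].

Definition top_map (phi : distributor R T n) : top_domain -> mapsp X B :=
  fun z => dist phi n z.1.2 z.2 z.1.1.

End TopMap.

(* Main.v *)
(** By universality a good n-distributor amounts to maps
    phi_a^{p_0, ..., p_n} : I^n -> T(A^{n+1}, B) depending continuously on
    a in T(A, B). The face equations prescribe them on the boundary of I^n in
    terms of phi^{n-1}, consistently on intersections of faces, and the wedge
    condition says that they lie over the constant map at (a, ..., a) along
    T(A^{n+1}, B) -> T(A, B)^{n+1}. The latter map is a trivial Serre fibration: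
    it is built from the binary ones of weak bilinearity. The admissible pairs
    (a, n-cube) form a space over T(A, B), whose projection inherits the lifting
    properties of a trivial fibration, as lifting an m-cube to it is a lifting
    problem for (m + n)-cubes against T(A^{n+1}, B) -> T(A, B)^{n+1}. Since
    T(A, B) is Serre cofibrant, the projection has a section. Two distributors
    with the same boundary values are compared by the same argument on
    I^{n+1} = I x I^n. *)

Require Import Defs.
From mathcomp Require Import all_boot all_order all_algebra.
From mathcomp Require Import all_classical all_reals all_analysis.
From mathcomp Require Import lra zify.

Set Implicit Arguments.
Unset Strict Implicit.
Unset Printing Implicit Defensive.

Import Order.TTheory GRing.Theory Num.Theory.
Import numFieldNormedType.Exports.
Local Open Scope classical_set_scope.
Local Open Scope ring_scope.

(** * Compact Hausdorff and weakly Hausdorff spaces *)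

(** The definitions and the argument speak of trivial fibrations in different terms. Weak
    bilinearity supplies homotopy lifting for cubes and bijections on homotopy groups, whereas
    extending a prescribed boundary needs lifting against the inclusion of the boundary of [I^n] in
    [I^n]. Conversely, cofibrancy applies to the space of fillings only once that space is known to
    satisfy the first description. Both passages are made by explicit deformations of cubes. The
    second obstacle is topological: products are k-ified, and the space of fillings must be CGWH.
    Continuity in parameters is therefore phrased through maps from compact Hausdorff spaces [K],
    where k-ification is invisible and currying cubes is harmless. The boundary values lie over the
    constant map at [(a, ..., a)] because each face expression is natural in the inputs and has
    value [ax] on a tuple whose only nonzero entry is [x]. Goodness is required in the top degree
    only; it descends because appending a zero entry makes a lower cube a face of a higher one. *)

Definition compact_hausdorff (K : topologicalType) : Prop :=
  compact [set: K] /\ hausdorff_space K.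

(* Continuity on the closed subset [A], phrased so that gluing along a finite
   closed cover is immediate; [C := setT] shows that [A] is closed. *)
Definition continuous_on (D E : topologicalType) (A : set D) (f : D -> E) :=
  forall C : set E, closed C -> closed (A `&` f @^-1` C).

Section ContinuousOn.
Context {D E : topologicalType}.
Implicit Types (A B : set D) (f g : D -> E).

Lemma continuous_continuous_on A f :
  closed A -> continuous f -> continuous_on A f.
Proof.
by move=> cA cf C cC; apply: closedI => //; apply: closed_comp => // ? _; exact: cf.
Qed.

Lemma continuous_onT f : continuous_on setT f -> continuous f.
Proof. by move=> cf; apply/continuous_closedP => C /cf; rewrite setTI. Qed.

Lemma eq_continuous_on A f g :
  (forall x, A x -> f x = g x) -> continuous_on A f -> continuous_on A g.
Proof.
move=> fg cf C /cf; congr closed; apply/seteqP.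
by split=> x [Ax] /= => [|]; [rewrite fg|rewrite -fg].
Qed.

Lemma continuous_onU A B f :
  continuous_on A f -> continuous_on B f -> continuous_on (A `|` B) f.
Proof. by move=> cA cB C cC; rewrite setIUl; apply: closedU; auto. Qed.

Lemma continuous_on_bigcup (I : finType) (F : I -> set D) f :
  (forall i, continuous_on (F i) f) -> continuous_on (\bigcup_i F i) f.
Proof.
move=> cF C cC; rewrite setI_bigcupl.
by apply: closed_bigcup => [|i _]; [exact: finite_finset|exact: cF].
Qed.

End ContinuousOn.

Lemma continuous_preimage_closed (D E : topologicalType) (f : D -> E) (C : set E) :
  continuous f -> closed C -> closed (f @^-1` C).
Proof. by move=> cf cC; apply: closed_comp => // ? _; exact: cf. Qed.

Lemma continuous_on_comp (D D' E : topologicalType) (A : set D) (A' : set D')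
    (r : D' -> D) (f : D -> E) :
  closed A' -> continuous r -> (forall x, A' x -> A (r x)) ->
  continuous_on A f -> continuous_on A' (f \o r).
Proof.
move=> cA' cr rA cf C /cf cC.
have -> : A' `&` (f \o r) @^-1` C = A' `&` r @^-1` (A `&` f @^-1` C).
  by apply/seteqP; split=> x [A'x] /=; [split=> //; split=> //; exact: rA|case].
by apply: closedI => //; exact: continuous_preimage_closed.
Qed.

Lemma continuous_comp_on (D E F : topologicalType) (A : set D)
    (f : D -> E) (g : E -> F) :
  continuous_on A f -> continuous g -> continuous_on A (g \o f).
Proof.
by move=> cf cg C cC; rewrite comp_preimage; apply: cf; exact: continuous_preimage_closed.
Qed.

Section Pairs.
Context {X Y Z : topologicalType}.

Lemma continuous_pair (f : Z -> X) (g : Z -> Y) :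
  continuous f -> continuous g -> continuous (fun z => (f z, g z)).
Proof. by move=> cf cg z; apply: cvg_pair => /=; [exact: cf|exact: cg]. Qed.

Lemma fst_continuous : continuous (fst : X * Y -> X).
Proof. by move=> z; exact: cvg_fst. Qed.

Lemma snd_continuous : continuous (snd : X * Y -> Y).
Proof. by move=> z; exact: cvg_snd. Qed.

Lemma comp_continuous (f : X -> Y) (g : Y -> Z) :
  continuous f -> continuous g -> continuous (g \o f).
Proof. by move=> cf cg x; apply: continuous_comp; [exact: cf|exact: cg]. Qed.

End Pairs.

Section Ptws.
Context {I : eqType} {T : I -> topologicalType} {Z : topologicalType}.

Lemma ptws_continuous (f : Z -> prod_topology T) :
  (forall i, continuous (fun z => f z i)) -> continuous f.
Proof.
move=> cf z; apply/cvg_sup => i.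
move=> U [_ [ [W oW <-] /= Wz WU]].
by apply: (filterS WU); apply: (cf i z); exact: open_nbhs_nbhs.
Qed.

Lemma ptws_proj_continuous i : continuous (fun t : prod_topology T => t i).
Proof. exact: (@proj_continuous I T i). Qed.

Lemma ptws_coord_continuous (f : Z -> prod_topology T) i :
  continuous f -> continuous (fun z => f z i).
Proof.
by move=> cf; exact: (comp_continuous cf (@ptws_proj_continuous i)).
Qed.

End Ptws.

Section SetType.
Context {X : topologicalType} {A : set X}.

Lemma set_val_continuous : continuous (set_val : set_type A -> X).
Proof. exact: initial_continuous. Qed.

Lemma set_type_continuous (Z : topologicalType) (f : Z -> set_type A) :
  continuous (set_val \o f) -> continuous f.
Proof. exact: continuous_comp_initial. Qed.

Lemma set_val_inj : injective (set_val : set_type A -> X).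
Proof. exact: val_inj. Qed.

End SetType.

Lemma hausdorff_joint (X : topologicalType) (I : Type) (Y : I -> topologicalType)
    (f : forall i, X -> Y i) :
  (forall i, continuous (f i)) -> (forall i, hausdorff_space (Y i)) ->
  (forall x x', (forall i, f i x = f i x') -> x = x') -> hausdorff_space X.
Proof.
move=> cf hY inj p q pq; apply: inj => i; apply: hY => U V nU nV.
by have [x [Ux Vx]] := pq _ _ (cf i _ _ nU) (cf i _ _ nV); exists (f i x).
Qed.

Section CompactHausdorff.

Lemma compact_hausdorff_set (D : topologicalType) (A : set D) :
  compact_hausdorff D -> closed A -> compact_hausdorff (set_type A).
Proof.
move=> [cD hD] cA; split; last first.
  apply: (@hausdorff_joint _ unit (fun=> D) (fun=> set_val)) => //.
  - by move=> _; exact: set_val_continuous.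
  - by move=> x x' /(_ tt); exact: set_val_inj.
have {cA}cA : compact A by exact: (subclosed_compact cA cD).
move=> F PF _.
have FA : (set_val @ F) A.
  by rewrite /= nbhs_simpl /=; apply: filterE => x; exact: set_valP.
have [p [Ap pF]] := cA (set_val @ F) _ FA.
exists (SigSub (mem_set Ap)); split=> // U V FU [_ [ [W oW <-] /= Wp WV]].
have [|_ [ [y Uy <-] Wy]] := pF (set_val @` U) W _ (open_nbhs_nbhs (conj oW Wp)).
  by rewrite /= nbhs_simpl /=; apply: (filterS _ FU) => y Uy; exists y.
by exists y; split=> //; exact: WV.
Qed.

Lemma compact_hausdorff_prod (D E : topologicalType) :
  compact_hausdorff D -> compact_hausdorff E -> compact_hausdorff (D * E)%type.
Proof.
move=> [cD hD] [cE hE]; split; first by rewrite -setXTT; exact: compact_setX.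
apply: (@hausdorff_joint _ bool (fun b => if b then D else E)
  (fun b => if b return D * E -> (if b then D else E) then fst else snd)).
- by case; [exact: fst_continuous|exact: snd_continuous].
- by case.
- by move=> [x y] [x' y'] e; congr pair; [exact: (e true)|exact: (e false)].
Qed.

Lemma compact_hausdorff_unit_interval (R : realType) :
  compact_hausdorff (unit_interval R).
Proof.
split; last first.
  apply: (@hausdorff_joint _ unit (fun=> R) (fun=> set_val)) => //.
  - by move=> _; exact: set_val_continuous.
  - by move=> x x' /(_ tt); exact: set_val_inj.
move=> F PF _.
have FA : (set_val @ F) [set` `[0, 1 : R]].
  by rewrite /= nbhs_simpl /=; apply: filterE => x; exact: set_valP.
have [p [Ap pF]] := @segment_compact R 0 1 (set_val @ F) _ FA.
exists (SigSub (mem_set Ap)); split=> // U V FU [_ [ [W oW <-] /= Wp WV]].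
have [|_ [ [y Uy <-] Wy]] := pF (set_val @` U) W _ (open_nbhs_nbhs (conj oW Wp)).
  by rewrite /= nbhs_simpl /=; apply: (filterS _ FU) => y Uy; exists y.
by exists y; split=> //; exact: WV.
Qed.

Lemma unit_interval_closed1 (R : realType) (s : unit_interval R) : closed [set s].
Proof.
have [_ hI] := compact_hausdorff_unit_interval R.
exact: accessible_closed_set1 (hausdorff_accessible hI) _.
Qed.

Lemma compact_hausdorff_cube (R : realType) n : compact_hausdorff (cube R n).
Proof.
have [cI hI] := compact_hausdorff_unit_interval R; split; last first.
  by apply: (@hausdorff_product _ (fun _ : 'I_n => unit_interval R)).
have := @tychonoff _ (fun _ : 'I_n => unit_interval R) (fun=> setT) (fun=> cI).
by congr compact; apply/seteqP; split.
Qed.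

End CompactHausdorff.

(** * k-ification, seen from compact Hausdorff spaces *)

Section Kify.
Context {X : topologicalType}.

Lemma kify_id_continuous : continuous (id : kify X -> X).
Proof.
apply/continuousP => U oU.
suff : @kopen X U by [].
by move=> K u _ _ /continuousP; exact.
Qed.

(** k-open sets are by definition those with open preimage under every such [u]. This lets k-ified
    products be treated as ordinary ones on compact Hausdorff sources. *)
Lemma continuous_into_kify (K : topologicalType) (u : K -> X) :
  compact_hausdorff K -> continuous u -> continuous (u : K -> kify X).
Proof. by move=> [cK hK] cu; apply/continuousP => U /(_ K u cK hK cu). Qed.

Lemma continuous_kify (Z : topologicalType) (f : kify X -> Z) :
  (forall (K : topologicalType) (u : K -> X), compact_hausdorff K ->
     continuous u -> continuous (f \o u)) -> continuous f.
Proof.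
move=> cf; apply/continuousP => U oU.
suff : @kopen X (f @^-1` U) by [].
move=> K u cK hK cu; rewrite -comp_preimage.
by have /continuousP := cf K u (conj cK hK) cu; exact.
Qed.

Lemma kify_compactly_generated : compactly_generated (kify X).
Proof.
move=> U kU.
suff : @kopen X U by [].
by move=> K u cK hK cu; apply: kU => //; exact: continuous_into_kify.
Qed.

End Kify.

Lemma continuous_compactly_generated (X Z : topologicalType) (f : X -> Z) :
  compactly_generated X ->
  (forall (K : topologicalType) (u : K -> X), compact_hausdorff K ->
     continuous u -> continuous (f \o u)) -> continuous f.
Proof.
move=> gX /continuous_kify cf; apply/continuousP => U oU; apply: gX.
by have /continuousP/(_ U oU) := cf.
Qed.

Section WeaklyHausdorff.

Lemma weakly_hausdorff_closed1 (X : topologicalType) (x : X) :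
  weakly_hausdorff X -> closed [set x].
Proof.
move=> wX.
have -> : [set x] = range (fun _ : bool => x).
  by apply/seteqP; split=> [_ -> |_ [_ _ <-//]]; exists true.
apply: wX; [|exact: discrete_hausdorff|by move=> ?; exact: cvg_cst].
exact/finite_compact/finite_finset.
Qed.

(* The image of a compact Hausdorff space in a weakly Hausdorff space is
   Hausdorff: closed maps with normal source have normal image. *)
Lemma weakly_hausdorff_separation (X K : topologicalType) (u : K -> X) (x y : X) :
  weakly_hausdorff X -> compact_hausdorff K -> continuous u ->
  range u x -> range u y -> x <> y ->
  exists U V : set X, [/\ open U, open V, U x, V y & U `&` V `&` range u = set0].
Proof.
move=> wX [cK hK] cu xu yu xy.
have closed_image C : closed C -> closed (u @` C).
  move=> cC; have [cC' hC'] := compact_hausdorff_set (conj cK hK) cC.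
  have -> : u @` C = range (u \o (set_val : set_type C -> K)).
    apply/seteqP; split=> [_ [k Ck <-]|_ [k _ <-]].
      by exists (SigSub (mem_set Ck)).
    by exists (set_val k) => //; exact: set_valP.
  apply: wX => //; apply: comp_continuous => //; exact: set_val_continuous.
have clf z : closed (u @^-1` [set z]).
  by apply: continuous_preimage_closed => //; exact: weakly_hausdorff_closed1.
have fxy : set_nbhs (u @^-1` [set x]) (~` (u @^-1` [set y])).
  move=> k /= ukx; apply: open_nbhs_nbhs; split; last by rewrite /= ukx.
  exact: closed_openC.
have [B /set_nbhsP[C [oC xC CB]] By] := compact_normal hK cK (clf x) fxy.
exists (~` (u @` (~` C))), (~` (u @` closure B)); split.
- by apply: closed_openC; apply: closed_image; exact: open_closedC.
- by apply: closed_openC; apply: closed_image; exact: closed_closure.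
- by move=> [k Ck ukx]; apply: Ck; exact: xC.
- by move=> [k /By] /=.
apply/seteqP; split=> // z [ [nC nB] [k _ uk]]; apply: nB; exists k => //.
apply/subset_closure/CB; apply: contrapT => Ck; apply: nC; by exists k.
Qed.

(** Given [y] in the closure of [range u], its neighbourhoods pull back to a filter on [K] with a
    cluster point [k]. If [f i] distinguished [u k] from [y], then [f i y] would still lie in the
    closed image of [f i \o u], and separating the two points inside that image would contradict
    clustering. *)
Lemma weakly_hausdorff_joint (X : topologicalType) (I : Type)
    (Y : I -> topologicalType) (f : forall i, X -> Y i) :
  (forall i, continuous (f i)) -> (forall i, weakly_hausdorff (Y i)) ->
  (forall x x', (forall i, f i x = f i x') -> x = x') -> weakly_hausdorff X.
Proof.
move=> cf wY inj K u cK hK cu y uy.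
pose F := filter_from (nbhs y) (fun W => u @^-1` W).
have PF : ProperFilter F.
  apply: filter_from_proper; last first.
    by move=> W /uy[_ [[k _ <-] Wk]]; exists k.
  apply: filter_from_filter; first by exists setT; exact: filterT.
  by move=> V W nV nW; exists (V `&` W); first exact: filterI.
have [k [_ kF]] := cK F PF filterT.
exists k => //; apply: inj => i; apply: contrapT => kNy.
have cfu : continuous (f i \o u) by exact: comp_continuous.
have fy : range (f i \o u) (f i y).
  apply: (wY i _ _ cK hK cfu) => W /cf /uy[_ [[k' _ <-] Wk']].
  by exists (f i (u k')); split=> //; exists k'.
have [|U [V [oU oV Uk Vy UV]]] :=
  weakly_hausdorff_separation (wY i) (conj cK hK) cfu _ fy kNy.
  by exists k.
have [||k' [Vk' Uk']] := kF (u @^-1` (f i @^-1` V)) ((f i \o u) @^-1` U).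
- by exists (f i @^-1` V) => //; apply: cf; exact: open_nbhs_nbhs.
- by apply: cfu; exact: open_nbhs_nbhs.
suff : set0 (f i (u k')) by [].
by rewrite -UV; split=> //; exists k'.
Qed.

End WeaklyHausdorff.

Section Currying.
Context {K V E : topologicalType}.

Lemma compact_hausdorff_locally_compact :
  compact_hausdorff V -> locally_compact [set: V].
Proof.
move=> [cV hV] x _; rewrite withinET; exists setT; first exact: filterT.
by split=> //; exact: closedT.
Qed.

(** The compact-open type contains all functions, so continuity of each [f k] has to be assumed
    separately. *)
Lemma continuous_uncurry_compact (f : K -> {compact-open, V -> E}) :
  compact_hausdorff V -> continuous f -> (forall k, continuous (f k)) ->
  continuous (fun z : K * V => f z.1 z.2).
Proof.
move=> hV cf cfk.
have -> : (fun z : K * V => f z.1 z.2) = uncurry (f : K -> V -> E).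
  by apply/funext => -[].
apply: continuous_uncurry => //; last by case: hV.
exact: compact_hausdorff_locally_compact.
Qed.

Lemma continuous_curry_compact (f : K -> V -> E) :
  continuous (fun z : K * V => f z.1 z.2) ->
  continuous (f : K -> {compact-open, V -> E}).
Proof. by move=> /continuous_curry_fun. Qed.

Lemma compact_open_eval_continuous (v : V) :
  continuous (fun f : {compact-open, V -> E} => f v).
Proof.
move=> f U; rewrite nbhsE => -[W [oW Wf] WU].
have : open_nbhs f ([set g | g @` [set v] `<=` W] : set {compact-open, V -> E}).
  split; first by apply: compact_open_open => //; exact: compact_set1.
  by move=> _ [_ -> <-].
move=> /open_nbhs_nbhs; apply: filterS => g gW.
by apply: WU; apply: gW; exists v.
Qed.

(** The inclusion of [set_type A * V] into [K * V] goes from a compact space to a Hausdorff one, so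
    it carries closed sets to closed sets. *)
Lemma continuous_on_uncurry (A : set K) (F : K -> V -> E) :
  compact_hausdorff K -> compact_hausdorff V -> closed A ->
  continuous (fun z : set_type A * V => F (set_val z.1) z.2) ->
  continuous_on [set z : K * V | A z.1] (fun z => F z.1 z.2).
Proof.
move=> hK hV cA cF C cC.
have [cKV hKV] := compact_hausdorff_prod hK hV.
have [cAV hAV] := compact_hausdorff_prod (compact_hausdorff_set hK cA) hV.
pose i (z : set_type A * V) : K * V := (set_val z.1, z.2).
have ci : continuous i.
  apply: continuous_pair; last exact: snd_continuous.
  exact: (comp_continuous fst_continuous set_val_continuous).
pose D : set (set_type A * V) := (fun z => F (set_val z.1) z.2) @^-1` C.
have -> : [set z | A z.1] `&` (fun z => F z.1 z.2) @^-1` C = i @` D.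
  apply/seteqP; split=> [[k v] [/= Ak Ck]|_ [[k v] Dk <-]] /=.
    by exists (SigSub (mem_set Ak), v).
  by split=> //; exact: set_valP.
apply: compact_closed => //; apply: continuous_compact.
  exact: continuous_subspaceT.
by apply: (subclosed_compact _ cAV) => //; exact: continuous_preimage_closed.
Qed.

Lemma continuous_on_set_val (A : set K) (f : K -> E) :
  continuous_on A f -> continuous (f \o (set_val : set_type A -> K)).
Proof.
move=> cf; apply/continuous_closedP => C /cf cC.
have -> : (f \o set_val) @^-1` C = (set_val : set_type A -> K) @^-1` (A `&` f @^-1` C).
  by apply/seteqP; split=> x //=; [split=> //; exact: set_valP|case].
exact: (continuous_preimage_closed set_val_continuous).
Qed.

End Currying.

(** * Cubes *)

Section RealContinuity.
Context {R : realType} {D : topologicalType}.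
Implicit Types f g : D -> R.

Lemma addr_continuous f g :
  continuous f -> continuous g -> continuous (fun d => f d + g d).
Proof. by move=> cf cg d; apply: (@cvgD _ R^o); [exact: cf|exact: cg]. Qed.

Lemma subr_continuous f g :
  continuous f -> continuous g -> continuous (fun d => f d - g d).
Proof. by move=> cf cg d; apply: (@cvgB _ R^o); [exact: cf|exact: cg]. Qed.

Lemma mulr_continuous f g :
  continuous f -> continuous g -> continuous (fun d => f d * g d).
Proof. by move=> cf cg d; apply: cvgM; [exact: cf|exact: cg]. Qed.

Lemma minr_continuous f g :
  continuous f -> continuous g -> continuous (fun d => Num.min (f d) (g d)).
Proof. by move=> cf cg d; apply: continuous_min; [exact: cf|exact: cg]. Qed.

Lemma maxr_continuous f g :
  continuous f -> continuous g -> continuous (fun d => Num.max (f d) (g d)).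
Proof. by move=> cf cg d; apply: continuous_max; [exact: cf|exact: cg]. Qed.

Lemma normr_continuous f : continuous f -> continuous (fun d => `|f d|).
Proof. by move=> cf d; apply: (@cvg_norm _ R^o); exact: cf. Qed.

Lemma constant_continuous (E : topologicalType) (e : E) : continuous (fun _ : D => e).
Proof. by move=> d; exact: cvg_cst. Qed.

Lemma le_closed f g :
  continuous f -> continuous g -> closed [set d | f d <= g d].
Proof.
move=> cf cg.
have -> : [set d | f d <= g d] = (fun d => g d - f d) @^-1` [set x | 0 <= x].
  by apply/seteqP; split=> d /=; rewrite subr_ge0.
by apply: continuous_preimage_closed; [exact: subr_continuous|exact: closed_ge].
Qed.

End RealContinuity.

Section UnitInterval.
Context {R : realType}.
Local Notation I := (unit_interval R).

Definition uval (s : I) : R := set_val s.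

Lemma uval_continuous : continuous uval.
Proof. exact: set_val_continuous. Qed.

Lemma uval_ge0 (s : I) : 0 <= uval s.
Proof. by have := set_valP s; rewrite /= in_itv /= => /andP[]. Qed.

Lemma uval_le1 (s : I) : uval s <= 1.
Proof. by have := set_valP s; rewrite /= in_itv /= => /andP[]. Qed.

Lemma uval_inj : injective uval.
Proof. exact: set_val_inj. Qed.

Lemma uval0 : uval (i0 R) = 0. Proof. by []. Qed.
Lemma uval1 : uval (i1 R) = 1. Proof. by []. Qed.

Lemma i0_neq_i1 : i0 R <> i1 R.
Proof. by move=> /(congr1 uval)/eqP; rewrite uval0 uval1 eq_sym oner_eq0. Qed.

Fact clamp_subproof (x : R) : Num.max 0 (Num.min 1 x) \in `[0, 1]%classic.
Proof.
by rewrite inE /= in_itv /= le_max lexx ge_max ler01 ge_min lexx.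
Qed.

Definition clamp (x : R) : I := SigSub (clamp_subproof x).

Lemma uval_clamp x : uval (clamp x) = Num.max 0 (Num.min 1 x).
Proof. by []. Qed.

Lemma clampK s : clamp (uval s) = s.
Proof.
apply: uval_inj; rewrite uval_clamp (min_idPr _) ?uval_le1 //.
by rewrite (max_idPr _) ?uval_ge0.
Qed.

Lemma clamp_le0 x : x <= 0 -> clamp x = i0 R.
Proof.
move=> x0; apply: uval_inj; rewrite uval_clamp uval0.
by apply/max_idPl; rewrite ge_min x0 orbT.
Qed.

Lemma clamp_ge1 x : 1 <= x -> clamp x = i1 R.
Proof.
move=> x0; apply: uval_inj; rewrite uval_clamp uval1 (min_idPl _) //.
by apply/max_idPr.
Qed.

Lemma clamp_continuous (D : topologicalType) (f : D -> R) :
  continuous f -> continuous (fun d => clamp (f d)).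
Proof.
move=> cf; apply: set_type_continuous.
apply: maxr_continuous; first exact: constant_continuous.
by apply: minr_continuous => //; exact: constant_continuous.
Qed.

Lemma uval_comp_continuous (D : topologicalType) (f : D -> I) :
  continuous f -> continuous (fun d => uval (f d)).
Proof. by move=> cf; exact: (comp_continuous cf uval_continuous). Qed.

End UnitInterval.

Section Cubes.
Context {R : realType}.
Local Notation I := (unit_interval R).
Local Notation cube := (cube R).

Lemma cube_continuous (D : topologicalType) n (f : D -> cube n) :
  (forall i, continuous (fun d => f d i)) -> continuous f.
Proof. exact: ptws_continuous. Qed.

Lemma cube_coord_continuous (D : topologicalType) n (f : D -> cube n) i :
  continuous f -> continuous (fun d => uval (f d i)).
Proof.
move=> cf; apply: uval_comp_continuous.
exact: (@ptws_coord_continuous _ (fun _ : 'I_n => I) _ f i).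
Qed.

(** Sup-norm distance from the centre, scaled to be 1 on the boundary. On the 0-cube it is 0, in
    accordance with the empty boundary. *)
Definition cube_radius n (t : cube n) : R :=
  \big[Num.max/0]_(i < n) `|2 * uval (t i) - 1|.

Lemma cube_radius_continuous n : continuous (@cube_radius n).
Proof.
apply: (@continuous_big _ _ (Num.max : R -> R -> R)).
  by apply: maxr_continuous; [exact: fst_continuous|exact: snd_continuous].
move=> i _; apply: normr_continuous.
apply: subr_continuous; last exact: constant_continuous.
apply: mulr_continuous; first exact: constant_continuous.
apply: (@cube_coord_continuous _ _ id) => t; exact: cvg_id.
Qed.

Lemma cube_radius_ge n (t : cube n) c :
  0 < c -> c <= cube_radius t -> exists i, c <= `|2 * uval (t i) - 1|.
Proof.
move=> c0 /bigmax_geP[|[i _ ci]]; last by exists i.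
by rewrite leNgt c0.
Qed.

Lemma cube_radius_ge0 n (t : cube n) : 0 <= cube_radius t.
Proof. exact: bigmax_ge_id. Qed.

Lemma cube_radius_le1 n (t : cube n) : cube_radius t <= 1.
Proof.
apply: bigmax_le => // i _; have := uval_ge0 (t i); have := uval_le1 (t i).
by rewrite ler_norml; lra.
Qed.

Lemma cube_radius_boundary n (t : cube n) : cube_boundary t -> cube_radius t = 1.
Proof.
move=> [i ti]; apply: le_anti; rewrite cube_radius_le1 /=.
apply: le_trans (le_bigmax _ _ i).
case: ti => ->; first by rewrite uval0 mulr0 sub0r normrN1.
by rewrite uval1 ler_normr; apply/orP; left; lra.
Qed.

Lemma boundary_radius n (t : cube n) : 1 <= cube_radius t -> cube_boundary t.
Proof.
move=> /cube_radius_ge[//|i H]; exists i.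
have [ti0 ti1] := (uval_ge0 (t i), uval_le1 (t i)).
have [le0|ge0] := leP (2 * uval (t i) - 1) 0.
  by left; apply: uval_inj; rewrite uval0; move: H; rewrite ler0_norm //; lra.
by right; apply: uval_inj; rewrite uval1; move: H; rewrite gtr0_norm //; lra.
Qed.

Lemma cube_boundary_closed n : closed (@cube_boundary R n).
Proof.
have -> : @cube_boundary R n = [set t | 1 <= cube_radius t].
  by apply/seteqP; split=> t; [move=> /cube_radius_boundary /= ->|exact: boundary_radius].
by apply: le_closed; [exact: constant_continuous|exact: cube_radius_continuous].
Qed.

(* [stretch (t, s)] and [shrink (t, c)] are the homotheties about the centre of
   the cube with ratio [1 + s] and [c], the former followed by the projection
   of R^n onto the cube. *)
Definition stretch n (z : cube n * I) : cube n :=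
  fun i => clamp (2^-1 + (uval (z.1 i) - 2^-1) * (1 + uval z.2)).

Definition shrink n (t : cube n) (c : R) : cube n :=
  fun i => clamp (2^-1 + (uval (t i) - 2^-1) * c).

Lemma stretch_continuous n : continuous (@stretch n).
Proof.
apply: cube_continuous => i; apply: clamp_continuous.
apply: addr_continuous; first exact: constant_continuous.
apply: mulr_continuous.
  apply: subr_continuous; last exact: constant_continuous.
  exact: (@cube_coord_continuous _ _ fst i fst_continuous).
apply: addr_continuous; first exact: constant_continuous.
exact: (uval_comp_continuous snd_continuous).
Qed.

Lemma shrink_continuous (D : topologicalType) n (f : D -> cube n) (c : D -> R) :
  continuous f -> continuous c -> continuous (fun d => shrink (f d) (c d)).
Proof.
move=> cf cc; apply: cube_continuous => i; apply: clamp_continuous.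
apply: addr_continuous; first exact: constant_continuous.
apply: mulr_continuous => //.
by apply: subr_continuous; [exact: cube_coord_continuous|exact: constant_continuous].
Qed.

Lemma stretch0 n (t : cube n) : stretch (t, i0 R) = t.
Proof.
apply/funext => i; rewrite /stretch /= uval0 addr0 mulr1 addrC subrK.
exact: clampK.
Qed.

Lemma shrink1 n (t : cube n) : shrink t 1 = t.
Proof. by apply/funext => i; rewrite /shrink mulr1 addrC subrK clampK. Qed.

Lemma shrink0 n (t t' : cube n) : shrink t 0 = shrink t' 0.
Proof. by apply/funext => i; rewrite /shrink !mulr0. Qed.

(** A coordinate that realizes the radius is moved to distance at least [1/2] from the centre, so
    [clamp] makes it 0 or 1. *)
Lemma stretch_boundary n (t : cube n) (s : I) :
  1 <= (1 + uval s) * cube_radius t -> cube_boundary (stretch (t, s)).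
Proof.
have := uval_ge0 s; have := uval_le1 s; set c := uval s => c1 c0.
have d0 : 0 < 1 + c by lra.
rewrite -ler_pdivrMl // mulr1 => /cube_radius_ge[|i]; first by rewrite invr_gt0.
rewrite -(ler_pM2l d0) mulfV ?gt_eqF // => ti; exists i.
have [le0|ge0] := leP (2 * uval (t i) - 1) 0.
  left; apply: clamp_le0 => /=; rewrite -/c.
  by move: ti; rewrite ler0_norm //; nra.
right; apply: clamp_ge1 => /=; rewrite -/c.
by move: ti; rewrite gtr0_norm //; nra.
Qed.

End Cubes.

Section Cubical.
Context {R : realType}.
Local Notation I := (unit_interval R).
Local Notation cube := (cube R).

(** The retracts of cubes. Homotopy lifting passes to retracts, so products of cubes and intervals
    can be used as sources without reindexing coordinates. *)
Definition cubical (D : topologicalType) :=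
  exists N (e : D -> cube N) (e' : cube N -> D),
    [/\ continuous e, continuous e' & cancel e e'].

Lemma cubical_cube n : cubical (cube n).
Proof. by exists n, id, id; split=> // t; exact: cvg_id. Qed.

Lemma cubical_interval : cubical I.
Proof.
exists 1, (fun s => fun=> s), (fun t => t ord0); split=> //.
  by apply: cube_continuous => i s; exact: cvg_id.
exact: (@ptws_proj_continuous _ (fun _ : 'I_1 => I) ord0).
Qed.

Definition cube_join m n (z : cube m * cube n) : cube (m + n) :=
  fun i => match fintype.split i with inl j => z.1 j | inr j => z.2 j end.

Definition cube_split m n (t : cube (m + n)) : cube m * cube n :=
  (fun j => t (lshift n j), fun j => t (rshift m j)).

Lemma cube_join_continuous m n : continuous (@cube_join m n).
Proof.
apply: cube_continuous => i; rewrite /cube_join; case: fintype.split => j.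
  exact: (@ptws_coord_continuous _ (fun _ : 'I_m => I) _ fst j fst_continuous).
exact: (@ptws_coord_continuous _ (fun _ : 'I_n => I) _ snd j snd_continuous).
Qed.

Lemma cube_split_continuous m n : continuous (@cube_split m n).
Proof.
apply: continuous_pair; apply: cube_continuous => i;
  exact: (@ptws_proj_continuous _ (fun _ : 'I_(m + n) => I)).
Qed.

Lemma cube_joinK m n : cancel (@cube_join m n) (@cube_split m n).
Proof.
move=> [u v]; congr pair; apply/funext => i; rewrite /cube_join.
  by have -> : fintype.split (lshift n i) = inl i := unsplitK (inl i).
by have -> : fintype.split (rshift m i) = inr i := unsplitK (inr i).
Qed.

Lemma cube_splitK m n : cancel (@cube_split m n) (@cube_join m n).
Proof.
move=> t; apply/funext => i; rewrite /cube_join -{2}(splitK i).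
by case: fintype.split.
Qed.

Lemma cube_join_boundary m n (z : cube m * cube n) :
  cube_boundary (cube_join z) <-> cube_boundary z.1 \/ cube_boundary z.2.
Proof.
rewrite -{2 3}(cube_joinK z); set t := cube_join z; split=> [[i]|].
  by rewrite -(splitK i); case: fintype.split => j tj; [left|right]; exists j.
by move=> [[j tj]|[j tj]]; [exists (lshift n j)|exists (rshift m j)].
Qed.

Lemma cubical_prod (D D' : topologicalType) :
  cubical D -> cubical D' -> cubical (D * D')%type.
Proof.
move=> [m [e [e' [ce ce' eK]]]] [n [f [f' [cf cf' fK]]]].
exists (m + n)%N, (fun z => cube_join (e z.1, f z.2)),
  (fun t => (e' (cube_split t).1, f' (cube_split t).2)); split.
- apply: (@comp_continuous _ _ _ (fun z => (e z.1, f z.2)));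
    last exact: cube_join_continuous.
  apply: continuous_pair; first exact: (comp_continuous fst_continuous ce).
  exact: (comp_continuous snd_continuous cf).
- have cs := @cube_split_continuous m n.
  apply: continuous_pair.
    exact: (comp_continuous (comp_continuous cs fst_continuous) ce').
  exact: (comp_continuous (comp_continuous cs snd_continuous) cf').
- by move=> [d d']; rewrite cube_joinK /= eK fK.
Qed.

Lemma compact_hausdorff_cubical (D : topologicalType) :
  cubical D -> compact_hausdorff D.
Proof.
move=> [n [e [e' [ce ce' eK]]]]; have [cN hN] := compact_hausdorff_cube R n; split.
  have -> : [set: D] = range e'.
    by apply/seteqP; split=> // d _; exists (e d); rewrite ?eK.
  by apply: continuous_compact => //; exact: continuous_subspaceT.
apply: (@hausdorff_joint _ unit (fun=> cube n) (fun=> e)) => //.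
by move=> d d' /(_ tt); exact: (can_inj eK).
Qed.

Definition cube_cons n (z : I * cube n) : cube n.+1 :=
  fun i => if unlift ord0 i is Some j then z.2 j else z.1.

Definition cube_uncons n (t : cube n.+1) : I * cube n :=
  (t ord0, fun j => t (lift ord0 j)).

Arguments cube_cons : simpl never.
Arguments cube_uncons : simpl never.

Lemma cube_cons_head n (z : I * cube n) : cube_cons z ord0 = z.1.
Proof. by rewrite /cube_cons unlift_none. Qed.

Lemma cube_uncons_head n (t : cube n.+1) : (cube_uncons t).1 = t ord0.
Proof. by []. Qed.

Lemma cube_cons_continuous n : continuous (@cube_cons n).
Proof.
apply: cube_continuous => i; rewrite /cube_cons.
case: unlift => [j|]; last exact: fst_continuous.
exact: (@ptws_coord_continuous _ (fun _ : 'I_n => I) _ snd j snd_continuous).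
Qed.

Lemma cube_uncons_continuous n : continuous (@cube_uncons n).
Proof.
apply: continuous_pair.
  exact: (@ptws_proj_continuous _ (fun _ : 'I_n.+1 => I)).
apply: cube_continuous => i.
exact: (@ptws_proj_continuous _ (fun _ : 'I_n.+1 => I)).
Qed.

Lemma cube_consK n : cancel (@cube_cons n) (@cube_uncons n).
Proof.
move=> [s t]; rewrite /cube_uncons /cube_cons unlift_none; congr pair.
by apply/funext => j; rewrite liftK.
Qed.

Lemma cube_unconsK n : cancel (@cube_uncons n) (@cube_cons n).
Proof.
by move=> t; apply/funext => i; rewrite /cube_cons; case: unliftP => [j|] ->.
Qed.

Lemma cube_cons_boundary n (z : I * cube n) :
  cube_boundary (cube_cons z) <-> (z.1 = i0 R \/ z.1 = i1 R) \/ cube_boundary z.2.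
Proof.
case: z => s t /=; split=> [[i]|[s01|[j tj]]].
- by rewrite /cube_cons; case: unliftP => [j|] _ /= ?; [right; exists j|left].
- by exists ord0; rewrite /cube_cons unlift_none.
- by exists (lift ord0 j); rewrite /cube_cons liftK.
Qed.

End Cubical.

Lemma bottom_closed (R : realType) (D : topologicalType) :
  closed [set z : D * unit_interval R | z.2 = i0 R].
Proof.
apply: (@continuous_preimage_closed _ _ snd [set i0 R]).
  exact: snd_continuous.
exact: unit_interval_closed1.
Qed.

(** * Lifting properties of trivial Serre fibrations *)

Section Lifting.
Context {R : realType} {E B : topologicalType}.
Local Notation I := (unit_interval R).
Local Notation cube := (cube R).
Variable p : E -> B.

Definition solvable (D : topologicalType) (A : set D) (g : D -> E) (h : D -> B) :=
  exists G : D -> E,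
    [/\ continuous G, forall d, A d -> G d = g d & forall d, p (G d) = h d].

(** The right lifting property against the inclusion of [A] in [D]. The partial lift [g] is a total
    function of which only the values on [A] matter, so gluing needs no subtypes. *)
Definition lifts (D : topologicalType) (A : set D) :=
  forall (g : D -> E) (h : D -> B), continuous_on A g -> continuous h ->
    (forall d, A d -> p (g d) = h d) -> solvable A g h.

Definition covering_homotopy :=
  forall D : topologicalType, @cubical R D ->
    lifts [set z : D * I | z.2 = i0 R].

Definition sphere_filling := forall n, lifts (@cube_boundary R n).

Lemma serre_covering_homotopy : serre_fibration R p -> covering_homotopy.
Proof.
move=> [_ hlp] D [N [e [e' [ce ce' eK]]]] g h cg ch pgh.
have [|||k [ck k0 pk]] := hlp N (fun t => g (e' t, i0 R)) (fun z => h (e' z.1, z.2)).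
- apply: continuous_onT.
  apply: (@continuous_on_comp _ _ _ _ _ (fun t => (e' t, i0 R)) g _ _ _ cg) => //.
  by apply: continuous_pair => //; exact: constant_continuous.
- apply: (@comp_continuous _ _ _ (fun z => (e' z.1, z.2)) h _ ch).
  apply: continuous_pair; last exact: snd_continuous.
  exact: (comp_continuous fst_continuous ce').
- by move=> t; rewrite pgh.
exists (fun z => k (e z.1, z.2)); split=> [|[d s] /= ->|[d s]].
- apply: (@comp_continuous _ _ _ (fun z => (e z.1, z.2)) k _ ck).
  apply: continuous_pair; last exact: snd_continuous.
  exact: (comp_continuous fst_continuous ce).
- by rewrite k0 eK.
- by rewrite pk /= eK.
Qed.

(** The pair [(D, A)] is a retract of [(D', A')]: the problem is pulled back along [e'] and its
    solution along [e]. *)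
Lemma lifts_transport (D D' : topologicalType) (A : set D) (A' : set D')
    (e : D -> D') (e' : D' -> D) :
  closed A' ->
  continuous e -> continuous e' -> cancel e e' -> (forall d', A' d' -> A (e' d')) ->
  (forall d, A d -> A' (e d)) -> lifts A' -> lifts A.
Proof.
move=> cA' ce ce' eK A'A AA' lA' g h cg ch pgh.
have [|||G [cG Gg pG]] := lA' (g \o e') (h \o e').
- exact: (continuous_on_comp cA' ce' A'A cg).
- exact: comp_continuous.
- by move=> d' A'd'; apply: pgh; exact: A'A.
exists (G \o e); split=> [|d Ad|d] /=; first exact: comp_continuous.
  by rewrite Gg /= ?eK //; exact: AA'.
by rewrite pG /= eK.
Qed.

(* [W] pushes [D] towards [A], reaching it at time [s] from every point where
   [rho] is at least [1 / (1 + s)]. Flowing along [W] while decreasing the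
   interval coordinate deforms [D * I] into [D * 0 `|` A * I] in time
   [phi <= 1], where [phi] vanishes on the latter; the lift is read off at time
   [phi] from a lift of the reversed flow. *)
Lemma collar_lifts (D : topologicalType) (A : set D) (rho : D -> R)
    (W : D * I -> D) :
  covering_homotopy -> @cubical R D -> closed A ->
  continuous rho -> continuous W -> (forall d, W (d, i0 R) = d) ->
  (forall d, A d -> rho d = 1) ->
  (forall d s, 1 <= (1 + uval s) * rho d -> A (W (d, s))) ->
  lifts [set z : D * I | z.2 = i0 R \/ A z.1].
Proof.
move=> hlp cD clA crho cW W0 Arho WA g h cg ch pgh.
pose J := [set z : D * I | z.2 = i0 R \/ A z.1].
(* The factor 2 leaves enough time to reach [A]. If [2 * (1 - rho) < s <= 1], then [rho > 1/2], and
   for [rho <= 1] one has [(1 + 2 * (1 - rho)) * rho - 1 = (2 * rho - 1) * (1 - rho) >= 0]. *)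
pose phi (z : D * I) := clamp (Num.min (uval z.2) (2 * (1 - rho z.1))).
pose F (z : (D * I) * I) : D * I :=
  (W (z.1.1, z.2), clamp (uval z.1.2 - uval z.2)).
pose H (z : (D * I) * I) := F (z.1, clamp (uval (phi z.1) - uval z.2)).
have cphi : continuous phi.
  apply: clamp_continuous; apply: minr_continuous.
    exact: (uval_comp_continuous snd_continuous).
  apply: mulr_continuous; first exact: constant_continuous.
  apply: subr_continuous; first exact: constant_continuous.
  exact: (comp_continuous fst_continuous crho).
have cF : continuous F.
  apply: continuous_pair.
    apply: (@comp_continuous _ _ _ (fun z => (z.1.1, z.2)) W _ cW).
    apply: continuous_pair; last exact: snd_continuous.
    exact: (comp_continuous fst_continuous fst_continuous).
  apply: clamp_continuous; apply: subr_continuous.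
    exact: (uval_comp_continuous (comp_continuous fst_continuous snd_continuous)).
  exact: (uval_comp_continuous snd_continuous).
have cH : continuous H.
  apply: (@comp_continuous _ _ _
    (fun z => (z.1, clamp (uval (phi z.1) - uval z.2))) F _ cF).
  apply: continuous_pair; first exact: fst_continuous.
  apply: clamp_continuous; apply: subr_continuous.
    exact: (uval_comp_continuous (comp_continuous fst_continuous cphi)).
  exact: (uval_comp_continuous snd_continuous).
have F0 z : F (z, i0 R) = z.
  by case: z => d s; rewrite /F /= W0 uval0 subr0 clampK.
have Hphi z : H (z, phi z) = z by rewrite /H /= subrr clamp_le0.
have HJ z : J (H (z, i0 R)).
  rewrite /H /= uval0 subr0 clampK /F; case: z => d s /=.
  have [le_s|lt_s] := leP (uval s) (2 * (1 - rho d)).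
    by left; rewrite /phi /= (min_idPl le_s) clampK clamp_le0 ?subrr.
  right; apply: WA; rewrite /phi /= (min_idPr (ltW lt_s)) uval_clamp.
  have s1 := uval_le1 s.
  have [rho1|rho1] := leP (rho d) 1; last first.
    have le0 : Num.min 1 (2 * (1 - rho d)) <= 0.
      by rewrite ge_min; apply/orP; right; lra.
    by rewrite (max_idPl le0) addr0 mul1r ltW.
  rewrite (min_idPr _); last lra.
  by rewrite (max_idPr _); nra.
have phiJ z : J z -> phi z = i0 R.
  case: z => d s [/= ->|/= /Arho rd]; apply: clamp_le0 => /=.
    by rewrite ge_min lexx.
  by rewrite rd ge_min subrr mulr0 lexx orbT.
pose r z := H (z, i0 R).
have cr : continuous r.
  apply: (@comp_continuous _ _ _ (fun z => (z, i0 R)) H _ cH).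
  by apply: continuous_pair; [move=> z; exact: cvg_id|exact: constant_continuous].
have [||||G [cG G0 pG]] :=
    @hlp (D * I)%type _ (fun z => g (r z.1)) (fun z => h (H z)).
- by apply: cubical_prod => //; exact: cubical_interval.
- apply: continuous_continuous_on.
    exact: bottom_closed.
  apply: (@comp_continuous _ _ _ fst (g \o r)); first exact: fst_continuous.
  apply: continuous_onT.
  by apply: (continuous_on_comp closedT cr _ cg) => z _; exact: HJ.
- exact: comp_continuous.
- by move=> [z s] /= ->; rewrite pgh //; exact: HJ.
exists (fun z => G (z, phi z)); split=> [|z Jz|z].
- apply: (@comp_continuous _ _ _ (fun z => (z, phi z)) G _ cG).
  by apply: continuous_pair => // z; exact: cvg_id.
- by rewrite G0 /= ?phiJ //= /r -(phiJ _ Jz) Hphi.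
- by rewrite pG Hphi.
Qed.

Lemma cube_collar_lifts n :
  covering_homotopy ->
  lifts [set z : cube n * I | z.2 = i0 R \/ cube_boundary z.1].
Proof.
move=> hlp; apply: (@collar_lifts (cube n) (@cube_boundary R n)
  (@cube_radius R n) (@stretch R n) hlp).
- exact: cubical_cube.
- exact: cube_boundary_closed.
- exact: cube_radius_continuous.
- exact: stretch_continuous.
- exact: stretch0.
- exact: cube_radius_boundary.
- exact: stretch_boundary.
Qed.

Lemma prod_cube_collar_lifts (U : topologicalType) n :
  covering_homotopy -> @cubical R U ->
  lifts [set z : (U * cube n) * I | z.2 = i0 R \/ cube_boundary z.1.2].
Proof.
move=> hlp cU.
apply: (@collar_lifts _ [set z : U * cube n | cube_boundary z.2]
  (fun z => cube_radius z.2) (fun z => (z.1.1, stretch (z.1.2, z.2)))) => //.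
- by apply: cubical_prod => //; exact: cubical_cube.
- apply: (@continuous_preimage_closed _ _ snd (@cube_boundary R n)).
    exact: snd_continuous.
  exact: cube_boundary_closed.
- exact: (comp_continuous snd_continuous (@cube_radius_continuous R n)).
- apply: continuous_pair.
    exact: (comp_continuous fst_continuous fst_continuous).
  apply: (@comp_continuous _ _ _ (fun z => (z.1.2, z.2)) (@stretch R n)).
    apply: continuous_pair; last exact: snd_continuous.
    exact: (comp_continuous fst_continuous snd_continuous).
  exact: stretch_continuous.
- by move=> [u t] /=; rewrite stretch0.
- by move=> [u t] /= /cube_radius_boundary.
- by move=> [u t] s /stretch_boundary.
Qed.

(** Solvability of a relative lifting problem is invariant under homotopies of the problem: a
    solution at time 0 and the partial lift over [A * I] form a problem on the box, whose solution
    is read off at time 1. *)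
Lemma solvable_homotopy (D : topologicalType) (A : set D)
    (g : D * I -> E) (h : D * I -> B) :
  closed A -> lifts [set z : D * I | z.2 = i0 R \/ A z.1] ->
  continuous_on [set z | A z.1] g -> continuous h ->
  (forall z, A z.1 -> p (g z) = h z) ->
  solvable A (fun d => g (d, i0 R)) (fun d => h (d, i0 R)) ->
  solvable A (fun d => g (d, i1 R)) (fun d => h (d, i1 R)).
Proof.
move=> clA lJ cg ch pgh [G [cG G0 pG]].
have cl0 := @bottom_closed R D.
pose k z := if z.2 == i0 R then G z.1 else g z.
have kg z : A z.1 -> k z = g z.
  by case: z => d s /= Ad; rewrite /k /=; case: eqP => // ->; rewrite G0.
have [|||K [cK Kk pK]] := lJ k h.
- have -> : [set z : D * I | z.2 = i0 R \/ A z.1] =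
            [set z | z.2 = i0 R] `|` [set z | A z.1] by [].
  apply: continuous_onU.
    apply: (@eq_continuous_on _ _ _ (G \o fst)) => [[d s] /= ->|].
      by rewrite /k eqxx.
    apply: continuous_continuous_on => //.
    exact: (comp_continuous fst_continuous).
  by apply: (eq_continuous_on _ cg) => z Az; rewrite kg.
- exact: ch.
- move=> [d s] [/= ->|Ad]; last by rewrite kg // pgh.
  by rewrite /k eqxx pG.
exists (fun d => K (d, i1 R)); split=> [|d Ad|d].
- apply: (@comp_continuous _ _ _ (fun d => (d, i1 R)) K _ cK).
  by apply: continuous_pair; [move=> d; exact: cvg_id|exact: constant_continuous].
- by rewrite Kk ?kg //=; right.
- by rewrite pK.
Qed.

End Lifting.

(** * Trivial Serre fibrations lift against the boundary inclusions of cubes *)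

Section SphereFilling.
Context {R : realType} {E B : topologicalType}.
Local Notation I := (unit_interval R).
Local Notation cube := (cube R).
Variable p : E -> B.

Lemma eq_solvable (D : topologicalType) (A : set D) (g g' : D -> E) (h h' : D -> B) :
  (forall d, A d -> g d = g' d) -> (forall d, h d = h' d) ->
  solvable p A g h -> solvable p A g' h'.
Proof.
move=> gg' hh' [G [cG Gg pG]]; exists G; split=> // d; last by rewrite pG.
by move=> Ad; rewrite Gg // gg'.
Qed.

Definition irev (s : I) : I := clamp (1 - uval s).

Lemma irev0 : irev (i0 R) = i1 R.
Proof. by apply: clamp_ge1; rewrite uval0 subr0. Qed.

Lemma irev1 : irev (i1 R) = i0 R.
Proof. by apply: clamp_le0; rewrite uval1 subrr. Qed.

Lemma irev_continuous : continuous irev.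
Proof.
apply: clamp_continuous; apply: subr_continuous; first exact: constant_continuous.
exact: uval_continuous.
Qed.

Lemma prod_boundary_closed (D : topologicalType) n :
  closed [set z : cube n * D | cube_boundary z.1].
Proof.
apply: (@continuous_preimage_closed _ _ fst (@cube_boundary R n)).
  exact: fst_continuous.
exact: cube_boundary_closed.
Qed.

Lemma homotopy_continuous (X Y : topologicalType) (H : kify (I * X)%type -> Y) :
  compact_hausdorff X -> continuous H -> continuous (H : I * X -> Y).
Proof.
move=> hX cH.
have hIX := compact_hausdorff_prod (compact_hausdorff_unit_interval R) hX.
apply: (@comp_continuous (I * X)%type (kify (I * X)%type) Y (fun z => z) H _ cH).
by apply: continuous_into_kify => // z; exact: cvg_id.
Qed.

Hypothesis hlp : @covering_homotopy R E B p.

(** When [W] starts at the identity, this replaces a problem by its pullback along the end of [W].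
    Time is reversed because [solvable_homotopy] carries solutions from time 0 to time 1. *)
Lemma solvable_deformation n (W : cube n * I -> cube n) (g : cube n -> E)
    (h : cube n -> B) :
  continuous W -> (forall z, cube_boundary z.1 -> cube_boundary (W z)) ->
  continuous_on (@cube_boundary R n) g -> continuous h ->
  (forall t, cube_boundary t -> p (g t) = h t) ->
  solvable p (@cube_boundary R n) (fun t => g (W (t, i1 R))) (fun t => h (W (t, i1 R))) ->
  solvable p (@cube_boundary R n) (fun t => g (W (t, i0 R))) (fun t => h (W (t, i0 R))).
Proof.
move=> cW bW cg ch pgh sol1.
pose W' z := W (z.1, irev z.2).
have cW' : continuous W'.
  apply: (@comp_continuous _ _ _ (fun z => (z.1, irev z.2)) W _ cW).
  apply: continuous_pair; first exact: fst_continuous.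
  exact: (comp_continuous snd_continuous irev_continuous).
have bW' z : cube_boundary z.1 -> cube_boundary (W' z).
  by move=> bz; apply: bW.
have := @solvable_homotopy R E B p _ (@cube_boundary R n) (g \o W') (h \o W').
rewrite /W' /= irev0 irev1; apply=> //.
- exact: cube_boundary_closed.
- exact: cube_collar_lifts.
- exact: (continuous_on_comp (@prod_boundary_closed I n) cW' bW' cg).
- exact: comp_continuous.
- by move=> z /bW' bz; apply: pgh.
Qed.

Hypothesis weq : weak_equivalence R p.

(** Here [h] is a spheroid at [p x]. Surjectivity on [pi_n] gives a spheroid at [x] whose image is
    homotopic to [h] relative to the boundary; it solves the problem at the start of that
    homotopy. *)
Lemma solvable_cst n (x : E) (h : cube n -> B) :
  (0 < n)%N -> continuous h -> (forall t, cube_boundary t -> p x = h t) ->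
  solvable p (@cube_boundary R n) (fun=> x) h.
Proof.
move=> n0 ch pxh; have [_ _ /(_ n x n0)[_ surj]] := weq.
have [|H [cH Hx] [K [cK K0 K1 Kb]]] := surj h.
  by split=> // t /pxh.
have {}cK := homotopy_continuous (compact_hausdorff_cube R n) cK.
apply: (@eq_solvable _ _ (fun=> x) _ (fun t => K (i1 R, t))) => //.
apply: (@solvable_homotopy R E B p _ (@cube_boundary R n) (fun=> x)
  (fun z => K (z.2, z.1))).
- exact: cube_boundary_closed.
- exact: cube_collar_lifts.
- apply: continuous_continuous_on; first exact: prod_boundary_closed.
  exact: constant_continuous.
- apply: (@comp_continuous _ _ _ (fun z => (z.2, z.1)) K _ cK).
  by apply: continuous_pair; [exact: snd_continuous|exact: fst_continuous].
- by move=> [t s] /= bt; rewrite Kb //= Hx.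
- by exists H; split=> // t; rewrite K0.
Qed.

(* The homotopy shrinks [G] to its value at the centre, and on [h] it inserts
   the trace of this shrinking in the collar [1 <= (1 + s) * cube_radius t]. *)
Lemma solvable_extension n (G : cube n -> E) (h : cube n -> B) :
  (0 < n)%N -> continuous G -> continuous h ->
  (forall t, cube_boundary t -> p (G t) = h t) ->
  solvable p (@cube_boundary R n) G h.
Proof.
move=> n0 cG ch pGh; have [cp _ _] := weq.
pose st (z : cube n * I) := stretch (z.1, irev z.2).
pose c (z : cube n * I) := (1 + uval (irev z.2)) * cube_radius z.1.
pose gg z := G (shrink (st z) (1 - uval (irev z.2))).
(* Where [c z = 1] the ratio [2 - c z] is 1 and [st z] lies on the boundary, so [gc] agrees with [h]
   there. On the boundary of the cube [c z] is 1 plus the value of [irev z.2], and the ratio becomes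
   that of [gg]. *)
pose gc z := p (G (shrink (st z) (2 - c z))).
pose hh z := if c z <= 1 then h (st z) else gc z.
have cst : continuous st.
  apply: (@comp_continuous _ _ _ (fun z => (z.1, irev z.2)) (@stretch R n));
    last exact: stretch_continuous.
  apply: continuous_pair; first exact: fst_continuous.
  exact: (comp_continuous snd_continuous irev_continuous).
have cirev : continuous (fun z : cube n * I => uval (irev z.2)).
  exact: (uval_comp_continuous (comp_continuous snd_continuous irev_continuous)).
have cc : continuous c.
  apply: mulr_continuous.
    by apply: addr_continuous => //; exact: constant_continuous.
  exact: (comp_continuous fst_continuous (@cube_radius_continuous R n)).
have cgg : continuous gg.
  apply: (@comp_continuous _ _ _ (fun z => shrink (st z) (1 - uval (irev z.2))) G _ cG).
  apply: shrink_continuous => //.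
  by apply: subr_continuous => //; exact: constant_continuous.
have cgc : continuous gc.
  apply: (comp_continuous _ cp).
  apply: (@comp_continuous _ _ _ (fun z => shrink (st z) (2 - c z)) G _ cG).
  apply: shrink_continuous => //.
  by apply: subr_continuous => //; exact: constant_continuous.
have hhgc z : 1 <= c z -> hh z = gc z.
  rewrite /hh; case: ifP => // c1 c1'.
  have cz : c z = 1 by apply: le_anti; rewrite c1.
  rewrite /gc cz (_ : 2 - 1 = 1) ?shrink1; last lra.
  by rewrite pGh //; apply: stretch_boundary; rewrite -/(c z) cz.
have chh : continuous hh.
  apply: continuous_onT.
  have -> : [set: cube n * I] = [set z | c z <= 1] `|` [set z | 1 <= c z].
    by apply/seteqP; split=> // z _; have /orP[] := le_total (c z) 1; [left|right].
  have c1 : closed [set z | c z <= 1] by apply: le_closed => //; exact: constant_continuous.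
  have c1' : closed [set z | 1 <= c z] by apply: le_closed => //; exact: constant_continuous.
  apply: continuous_onU.
    apply: (@eq_continuous_on _ _ _ (h \o st)) => [z /= cz|]; first by rewrite /hh cz.
    by apply: continuous_continuous_on => //; exact: comp_continuous.
  apply: (@eq_continuous_on _ _ _ gc) => [z /= cz|]; first by rewrite hhgc.
  exact: continuous_continuous_on.
have pgg z : cube_boundary z.1 -> p (gg z) = hh z.
  move=> /cube_radius_boundary bz.
  have cz : c z = 1 + uval (irev z.2) by rewrite /c bz mulr1.
  rewrite hhgc ?cz ?lerDl ?uval_ge0 // /gc /gg cz; congr (p (G (shrink _ _))).
  lra.
have shrinkc t t' : gg (t, i0 R) = gg (t', i0 R).
  by rewrite /gg /= irev0 uval1 subrr; congr G; exact: shrink0.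
have gg1 t : gg (t, i1 R) = G t.
  by rewrite /gg /st /= irev1 uval0 subr0 shrink1 stretch0.
have hh1 t : hh (t, i1 R) = h t.
  rewrite /hh /c /st /= irev1 uval0 addr0 mul1r stretch0.
  by rewrite cube_radius_le1.
apply: (@eq_solvable _ _ (fun t => gg (t, i1 R)) _ (fun t => hh (t, i1 R))) => //.
apply: solvable_homotopy => //.
- exact: cube_boundary_closed.
- exact: cube_collar_lifts.
- by apply: continuous_continuous_on => //; exact: prod_boundary_closed.
(* At time 0 the ratio in [gg] is 0, so [gg] is constant and [solvable_cst] applies. *)
- pose t0 : cube n := fun=> i0 R.
  apply: (@eq_solvable _ _ (fun=> gg (t0, i0 R)) _ (fun t => hh (t, i0 R))) => //.
  apply: solvable_cst => // [|t bt].
    apply: (@comp_continuous _ _ _ (fun t => (t, i0 R)) hh _ chh).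
    by apply: continuous_pair; [move=> t; exact: cvg_id|exact: constant_continuous].
  by rewrite -(pgg (t, i0 R)) // (shrinkc t0 t).
Qed.

(* In the coordinates [z = cube_cons (t, y)], the box [J] is [box_radius = 1].
   The maps [box_stretch] and [box_shrink] preserve the boundary; starting from
   the identity they lead to a map sending [J] to a single point. *)
Definition box_radius n (z : cube n.+1) : R :=
  let: (t, y) := cube_uncons z in Num.max (cube_radius y) (1 - 2 * uval t).

Definition box_stretch n (zs : cube n.+1 * I) : cube n.+1 :=
  let: (z, s) := zs in let: (t, y) := cube_uncons z in
  cube_cons (clamp (Num.min (uval t) (1 - 2 * ((1 + uval s) * box_radius z - 1))),
             stretch (y, s)).

Definition box_shrink n (zs : cube n.+1 * I) : cube n.+1 :=
  let: (z, s) := zs in let: (t, y) := cube_uncons z in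
  cube_cons (clamp (Num.min (uval t) (3 - 4 * box_radius z)),
             shrink (stretch (y, i1 R))
               (1 - uval s + uval s * Num.min 1 (4 * (1 - box_radius z)))).

Arguments box_radius : simpl never.
Arguments box_stretch : simpl never.
Arguments box_shrink : simpl never.

Lemma box_radiusE n t (y : cube n) :
  box_radius (cube_cons (t, y)) = Num.max (cube_radius y) (1 - 2 * uval t).
Proof. by rewrite /box_radius cube_consK. Qed.

Lemma box_stretchE n t (y : cube n) s (rho := box_radius (cube_cons (t, y))) :
  box_stretch (cube_cons (t, y), s) =
  cube_cons (clamp (Num.min (uval t) (1 - 2 * ((1 + uval s) * rho - 1))),
             stretch (y, s)).
Proof. by rewrite /box_stretch cube_consK. Qed.

Lemma box_shrinkE n t (y : cube n) s (rho := box_radius (cube_cons (t, y))) :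
  box_shrink (cube_cons (t, y), s) =
  cube_cons (clamp (Num.min (uval t) (3 - 4 * rho)),
             shrink (stretch (y, i1 R))
               (1 - uval s + uval s * Num.min 1 (4 * (1 - rho)))).
Proof. by rewrite /box_shrink cube_consK. Qed.

Lemma box_radius_continuous n : continuous (@box_radius n).
Proof.
have cu := @cube_uncons_continuous R n.
apply: maxr_continuous.
  exact: (comp_continuous (comp_continuous cu snd_continuous)
    (@cube_radius_continuous R n)).
apply: subr_continuous; first exact: constant_continuous.
apply: mulr_continuous; first exact: constant_continuous.
exact: (uval_comp_continuous (comp_continuous cu fst_continuous)).
Qed.

Lemma box_radius_le1 n (z : cube n.+1) : box_radius z <= 1.
Proof.
rewrite -(cube_unconsK z); case: cube_uncons => t y; rewrite box_radiusE ge_max cube_radius_le1 /=.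
by have := uval_ge0 t; lra.
Qed.

Lemma box_stretch_continuous n : continuous (@box_stretch n).
Proof.
have cu := @cube_uncons_continuous R n.
have cz : continuous (fst : cube n.+1 * I -> cube n.+1) := fst_continuous.
have cs : continuous (fun zs : cube n.+1 * I => uval zs.2).
  exact: (uval_comp_continuous snd_continuous).
have -> : @box_stretch n = fun zs => cube_cons
    (clamp (Num.min (uval (cube_uncons zs.1).1)
                    (1 - 2 * ((1 + uval zs.2) * box_radius zs.1 - 1))),
     stretch ((cube_uncons zs.1).2, zs.2)).
  by apply/funext => -[].
apply: (comp_continuous _ (@cube_cons_continuous R n)).
apply: continuous_pair.
  apply: clamp_continuous; apply: minr_continuous.
    exact: (uval_comp_continuous (comp_continuous (comp_continuous cz cu) fst_continuous)).
  apply: subr_continuous; first exact: constant_continuous.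
  apply: mulr_continuous; first exact: constant_continuous.
  apply: subr_continuous; last exact: constant_continuous.
  apply: mulr_continuous; last exact: (comp_continuous cz (@box_radius_continuous n)).
  by apply: addr_continuous => //; exact: constant_continuous.
apply: (comp_continuous _ (@stretch_continuous R n)).
apply: continuous_pair; last exact: snd_continuous.
exact: (comp_continuous (comp_continuous cz cu) snd_continuous).
Qed.

Lemma box_shrink_continuous n : continuous (@box_shrink n).
Proof.
have cu := @cube_uncons_continuous R n.
have cz : continuous (fst : cube n.+1 * I -> cube n.+1) := fst_continuous.
have cs : continuous (fun zs : cube n.+1 * I => uval zs.2).
  exact: (uval_comp_continuous snd_continuous).
have cr := comp_continuous cz (@box_radius_continuous n).
have -> : @box_shrink n = fun zs => cube_cons
    (clamp (Num.min (uval (cube_uncons zs.1).1) (3 - 4 * box_radius zs.1)),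
     shrink (stretch ((cube_uncons zs.1).2, i1 R))
       (1 - uval zs.2 + uval zs.2 * Num.min 1 (4 * (1 - box_radius zs.1)))).
  by apply/funext => -[].
apply: (comp_continuous _ (@cube_cons_continuous R n)).
apply: continuous_pair.
  apply: clamp_continuous; apply: minr_continuous.
    exact: (uval_comp_continuous (comp_continuous (comp_continuous cz cu) fst_continuous)).
  apply: subr_continuous; first exact: constant_continuous.
  by apply: mulr_continuous => //; exact: constant_continuous.
apply: shrink_continuous.
  apply: (comp_continuous _ (@stretch_continuous R n)).
  apply: continuous_pair; last exact: constant_continuous.
  exact: (comp_continuous (comp_continuous cz cu) snd_continuous).
apply: addr_continuous.
  by apply: subr_continuous => //; exact: constant_continuous.
apply: mulr_continuous => //.
apply: minr_continuous; first exact: constant_continuous.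
apply: mulr_continuous; first exact: constant_continuous.
by apply: subr_continuous => //; exact: constant_continuous.
Qed.

Lemma box_stretch0 n (z : cube n.+1) : box_stretch (z, i0 R) = z.
Proof.
rewrite -(cube_unconsK z); case: cube_uncons => t y.
rewrite box_stretchE stretch0 uval0 addr0 mul1r (min_idPl _) ?clampK //.
by have := box_radius_le1 (cube_cons (t, y)); have := uval_le1 t; lra.
Qed.

Lemma box_shrink0 n (z : cube n.+1) : box_shrink (z, i0 R) = box_stretch (z, i1 R).
Proof.
rewrite -(cube_unconsK z); case: cube_uncons => t y.
rewrite box_shrinkE box_stretchE uval0 uval1 subr0 mul0r addr0 shrink1.
by congr (cube_cons (clamp (Num.min _ _), _)); lra.
Qed.

(** Only the top face needs an argument. There the box radius is the radius of [y]: if [(1 + s)]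
    times it is at most 1, the first coordinate stays 1; otherwise [stretch] has already moved [y]
    to the boundary. *)
Lemma box_stretch_boundary n (zs : cube n.+1 * I) :
  cube_boundary zs.1 -> cube_boundary (box_stretch zs).
Proof.
case: zs => z s /=; have s0 := uval_ge0 s; have s1 := uval_le1 s.
rewrite -(cube_unconsK z); case: cube_uncons => t y.
rewrite box_stretchE box_radiusE !cube_cons_boundary /=.
move=> [[->|->]|by1].
- by left; left; apply: clamp_le0; rewrite ge_min uval0 lexx.
- have r0 : 0 <= cube_radius y := cube_radius_ge0 y.
  rewrite uval1 (max_idPl _); last lra.
  have [sr|sr] := leP ((1 + uval s) * cube_radius y) 1.
    by left; right; apply: clamp_ge1; rewrite le_min lexx /=; lra.
  by right; apply: stretch_boundary; exact: ltW.
- right; apply: stretch_boundary; rewrite cube_radius_boundary // mulr1; lra.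
Qed.

(** The constants match at radius [3/4]. From there on [3 - 4 * rho <= 0], so the point is in the
    bottom face however [y] is shrunk; below it the shrinking ratio is 1, and the map is
    [box_stretch] at time 1. *)
Lemma box_shrink_boundary n (zs : cube n.+1 * I) :
  cube_boundary zs.1 -> cube_boundary (box_shrink zs).
Proof.
case: zs => z s /=; rewrite -(cube_unconsK z); case: cube_uncons => t y bz.
have [r34|r34] := leP (3 / 4) (box_radius (cube_cons (t, y))).
  rewrite box_shrinkE cube_cons_boundary /=.
  by left; left; apply: clamp_le0; rewrite ge_min; apply/orP; right; lra.
have -> : box_shrink (cube_cons (t, y), s) = box_shrink (cube_cons (t, y), i0 R).
  rewrite !box_shrinkE (min_idPl (_ : 1 <= 4 * _)); last lra.
  by rewrite !mulr1 !subrK.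
by rewrite box_shrink0; exact: (@box_stretch_boundary _ (_, i1 R)).
Qed.

(** At radius 1 and time 1 the first coordinate is clamped to 0 and the ratio is 0, so both images
    are the centre of the bottom face. *)
Lemma box_shrink1 n (z z' : cube n.+1) :
  box_radius z = 1 -> box_radius z' = 1 -> box_shrink (z, i1 R) = box_shrink (z', i1 R).
Proof.
have box z1 : box_radius z1 = 1 -> box_shrink (z1, i1 R) =
    cube_cons (i0 R, shrink (fun=> i0 R) 0).
  rewrite -(cube_unconsK z1); case: cube_uncons => t y r1.
  rewrite box_shrinkE r1 clamp_le0; last by rewrite ge_min; apply/orP; right; lra.
  rewrite uval1 subrr mulr0 (min_idPr ler01) mulr0 addr0.
  by congr (cube_cons (_, _)); exact: shrink0.
by move=> /box -> /box ->.
Qed.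

Lemma box_radius_bottom n (y : cube n) : box_radius (cube_cons (i0 R, y)) = 1.
Proof.
rewrite box_radiusE uval0 mulr0 subr0.
by apply/max_idPr; exact: cube_radius_le1.
Qed.

Lemma box_radius_side n t (y : cube n) :
  cube_boundary y -> box_radius (cube_cons (t, y)) = 1.
Proof.
move=> by1; rewrite box_radiusE cube_radius_boundary //.
by apply/max_idPl; have := uval_ge0 t; lra.
Qed.

(* A sphere that is constant on the box is a spheroid in the remaining face;
   being null-homotopic in [B], it is null-homotopic in [E]. *)
Lemma extension_of_squashed n (x : E) (g : cube n.+1 -> E) (h : cube n.+1 -> B) :
  continuous_on (@cube_boundary R n.+1) g -> continuous h ->
  (forall t, cube_boundary t -> p (g t) = h t) ->
  (forall t, cube_boundary t -> box_radius t = 1 -> g t = x) ->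
  exists2 G : cube n.+1 -> E, continuous G & forall t, cube_boundary t -> G t = g t.
Proof.
move=> cg ch pgh gx.
pose top y := g (cube_cons (i1 R, y)).
have bot t y : t = i0 R \/ cube_boundary y -> g (cube_cons (t, y)) = x.
  move=> ty; apply: gx.
    by apply/cube_cons_boundary; case: ty; [left; left|right].
  by case: ty => [->|]; [exact: box_radius_bottom|exact: box_radius_side].
have hx t y : t = i0 R \/ cube_boundary y -> h (cube_cons (t, y)) = p x.
  move=> ty; rewrite -pgh ?bot //.
  by apply/cube_cons_boundary; case: ty; [left; left|right].
have ccons t : continuous (fun y : cube n => cube_cons (t, y)).
  apply: (comp_continuous _ (@cube_cons_continuous R n)).
  by apply: continuous_pair; [exact: constant_continuous|move=> y; exact: cvg_id].
have ctop : continuous top.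
  apply: continuous_onT; apply: (continuous_on_comp closedT (ccons (i1 R)) _ cg).
  by move=> y _; apply/cube_cons_boundary; left; right.
(* [irev] makes this homotopy start at the image of [top] and end on the bottom face, where [h] is
   constantly [p x]. *)
pose K (z : I * cube n) := h (cube_cons (irev z.1, z.2)).
have cK : continuous K.
  apply: (comp_continuous _ ch); apply: (comp_continuous _ (@cube_cons_continuous R n)).
  apply: continuous_pair; last exact: snd_continuous.
  exact: (comp_continuous fst_continuous irev_continuous).
have ptop y : p (top y) = h (cube_cons (i1 R, y)).
  by apply: pgh; apply/cube_cons_boundary; left; right.
have [K' [cK' K0 K1 Kb]] : exists K' : I * cube n -> E,
    [/\ continuous K', forall y, K' (i0 R, y) = top y, forall y, K' (i1 R, y) = x &
        forall s y, cube_boundary y -> K' (s, y) = x].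
  have [_ [inj0 _] inj] := weq.
  (* For [n = 0] the remaining face is a single point, and injectivity on path components takes the
     place of injectivity on [pi_n]. *)
  have [n0|n0] := posnP n.
    have y0 (y : cube n) : y = fun=> i0 R.
      by apply/funext => j; exfalso; have := ltn_ord j; lia.
    have [|c [cc c0 c1]] := inj0 (top (fun=> i0 R)) x.
      exists (fun s => K (s, fun=> i0 R)); split.
      - apply: (@comp_continuous _ _ _ (fun s => (s, (fun=> i0 R) : cube n)) K _ cK).
        by apply: continuous_pair; [move=> s; exact: cvg_id|exact: constant_continuous].
      - by rewrite /K irev0 ptop.
      - by rewrite /K irev1 hx //; left.
    exists (fun z => c z.1); split=> [|y|//|s y [j]].
    - exact: (comp_continuous fst_continuous cc).
    - by rewrite c0 (y0 y).
    - by exfalso; have := ltn_ord j; lia.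
  have [inj' _] := inj n x n0.
  have [|||H [cH H0 H1 Hb]] := inj' top (fun=> x).
  - by split=> // y by1; apply: bot; right.
  - by split=> //; exact: constant_continuous.
  - exists K; split=> [|y|y|s y by1].
    + exact: (@comp_continuous (kify (I * cube n)%type) (I * cube n)%type B
        (fun z => z) K kify_id_continuous cK).
    + by rewrite /K irev0 /= ptop.
    + by rewrite /K irev1 hx //; left.
    + by rewrite /K /= hx ?ptop ?hx //; right.
  exists H; split=> //.
    by apply: homotopy_continuous => //; exact: compact_hausdorff_cube.
  by move=> s y by1; rewrite Hb //; apply: bot; right.
exists (fun z => K' (irev (cube_uncons z).1, (cube_uncons z).2)).
  apply: (@comp_continuous _ _ _
    (fun z => (irev (cube_uncons z).1, (cube_uncons z).2)) K' _ cK').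
  have cu := @cube_uncons_continuous R n.
  apply: continuous_pair; last exact: (comp_continuous cu snd_continuous).
  exact: (comp_continuous (comp_continuous cu fst_continuous) irev_continuous).
move=> z; rewrite -{1 4}(cube_unconsK z) cube_cons_boundary.
case: (cube_uncons z) => t y /= [[->|->]|by1].
- by rewrite irev0 K1 bot //; left.
- by rewrite irev1 K0.
- by rewrite Kb // bot //; right.
Qed.

(** In positive dimension the two box deformations reduce to boundary data that are constant on the
    box; [extension_of_squashed] extends these to a cube in [E], with no control over [h] inside,
    and [solvable_extension] then corrects the inside. *)
Lemma weak_equivalence_sphere_filling : @sphere_filling R E B p.
Proof.
move=> [|n] g h cg ch pgh.
  (* In dimension 0 the boundary is empty. Surjectivity on path components gives a path from [p x]
     to the point prescribed by [h], and the end of its lift is the solution. *)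
  have [_ [_ /(_ (h (fun=> i0 R)))[x [c [cc c0 c1]]]] _] := weq.
  have [|||G [cG G0 pG]] := hlp (cubical_cube 0) (g := fun=> x) (h := fun z => c z.2).
  - by apply: continuous_continuous_on; [exact: bottom_closed|exact: constant_continuous].
  - exact: (comp_continuous snd_continuous cc).
  - by move=> [t s] /= ->.
  exists (fun t => G (t, i1 R)); split=> [|t [[]]//|t].
    apply: (@comp_continuous _ _ _ (fun t => (t, i1 R)) G _ cG).
    by apply: continuous_pair; [move=> t; exact: cvg_id|exact: constant_continuous].
  by rewrite pG /= c1; congr h; apply/funext => -[].
have W1 z : cube_boundary z.1 -> cube_boundary (@box_stretch n z).
  exact: box_stretch_boundary.
have W2 z : cube_boundary z.1 -> cube_boundary (@box_shrink n z).
  exact: box_shrink_boundary.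
apply: (@eq_solvable _ _ (fun t => g (box_stretch (t, i0 R))) _
  (fun t => h (box_stretch (t, i0 R)))).
  by move=> t _; rewrite box_stretch0.
  by move=> t; rewrite box_stretch0.
apply: solvable_deformation => //; first exact: box_stretch_continuous.
apply: (@eq_solvable _ _ (fun t => g (box_shrink (t, i0 R))) _
  (fun t => h (box_shrink (t, i0 R)))).
  by move=> t _; rewrite box_shrink0.
  by move=> t; rewrite box_shrink0.
apply: solvable_deformation => //; first exact: box_shrink_continuous.
pose r (t : cube n.+1) := box_shrink (t, i1 R).
have cr : continuous r.
  apply: (@comp_continuous _ _ _ (fun t => (t, i1 R)) (@box_shrink n)).
    by apply: continuous_pair; [move=> t; exact: cvg_id|exact: constant_continuous].
  exact: box_shrink_continuous.
have br t : cube_boundary t -> cube_boundary (r t) by exact: (W2 (t, i1 R)).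
pose z0 : cube n.+1 := cube_cons (i0 R, fun=> i0 R).
have [||||G cG Gg] := @extension_of_squashed n (g (r z0)) (g \o r) (h \o r).
- exact: (continuous_on_comp (@cube_boundary_closed R n.+1) cr br cg).
- exact: comp_continuous.
- by move=> t /br bt; exact: pgh.
- by move=> t _ t1 /=; congr g; apply: box_shrink1 => //; exact: box_radius_bottom.
apply: (@eq_solvable _ _ G _ (h \o r)) => //.
apply: solvable_extension => //; first exact: comp_continuous.
by move=> t bt; rewrite Gg //=; apply/pgh/br.
Qed.

End SphereFilling.

(** * From lifting properties back to Serre fibrations and weak equivalences *)

Section Converse.
Context {R : realType} {E B : topologicalType}.
Local Notation I := (unit_interval R).
Local Notation cube := (cube R).
Variable p : E -> B.

Lemma covering_homotopy_serre :
  continuous p -> @covering_homotopy R E B p -> serre_fibration R p.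
Proof.
move=> cp hlp; split=> // n g h cg ch h0.
have [|||G [cG G0 pG]] := hlp _ (cubical_cube n) (g \o fst) h.
- apply: continuous_continuous_on; first exact: bottom_closed.
  exact: (comp_continuous fst_continuous cg).
- exact: ch.
- by move=> [t s] /= ->; rewrite h0.
by exists G; split=> // t; rewrite G0.
Qed.

Lemma face_closed n (s : I) : closed [set z : cube n.+1 | z ord0 = s].
Proof.
apply: (@continuous_preimage_closed _ _ (fun z : cube n.+1 => z ord0) [set s]).
  exact: (@ptws_proj_continuous _ (fun _ : 'I_n.+1 => I)).
exact: unit_interval_closed1.
Qed.

(** The geometric form of injectivity on homotopy groups: the two ends and the constant sides
    prescribe a map on the boundary of an [n.+1]-cube, and a filling over [h] is the homotopy. *)
Lemma sphere_filling_cylinder n (f f' : cube n -> E) (x : E) (h : I * cube n -> B) :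
  @sphere_filling R E B p -> continuous f -> continuous f' ->
  (forall t, cube_boundary t -> f t = x) -> (forall t, cube_boundary t -> f' t = x) ->
  continuous h -> (forall t, h (i0 R, t) = p (f t)) ->
  (forall t, h (i1 R, t) = p (f' t)) ->
  (forall s t, cube_boundary t -> h (s, t) = p x) ->
  exists G : I * cube n -> E, [/\ continuous G, forall t, G (i0 R, t) = f t,
    forall t, G (i1 R, t) = f' t & forall s t, cube_boundary t -> G (s, t) = x].
Proof.
move=> sph cf cf' fx f'x ch h0 h1 hx.
have i10 : (i1 R == i0 R) = false by apply/eqP => /esym/i0_neq_i1.
pose g (z : cube n.+1) := let: (s, t) := cube_uncons z in
  if s == i0 R then f t else if s == i1 R then f' t else x.
have gE s t : g (cube_cons (s, t)) =
  if s == i0 R then f t else if s == i1 R then f' t else x.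
  by rewrite /g cube_consK.
have g0 t : g (cube_cons (i0 R, t)) = f t by rewrite gE eqxx.
have g1 t : g (cube_cons (i1 R, t)) = f' t by rewrite gE i10 eqxx.
have gx s t : cube_boundary t -> g (cube_cons (s, t)) = x.
  by move=> bt; rewrite gE fx ?f'x //; case: ifP => //; case: ifP.
have ctail : continuous (fun z : cube n.+1 => (cube_uncons z).2).
  exact: (comp_continuous (@cube_uncons_continuous R n) snd_continuous).
have [|||G [cG Gg _]] := sph n.+1 g (h \o @cube_uncons R n).
- have -> : @cube_boundary R n.+1 = ([set z | z ord0 = i0 R] `|`
      [set z | z ord0 = i1 R]) `|` [set z | cube_boundary (cube_uncons z).2].
    apply/seteqP; split=> z; rewrite -(cube_unconsK z); case: cube_uncons => s t;
      by rewrite cube_cons_boundary /= cube_cons_head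
        (congr1 snd (cube_consK (s, t)) : (fun j => _) = _).
  apply: continuous_onU; first apply: continuous_onU.
  + apply: (@eq_continuous_on _ _ _ (fun z => f (cube_uncons z).2)) => [z z0|].
      by rewrite -{2}(cube_unconsK z) [cube_uncons z]surjective_pairing cube_uncons_head z0 g0.
    apply: continuous_continuous_on; first exact: face_closed.
    exact: (comp_continuous ctail cf).
  + apply: (@eq_continuous_on _ _ _ (fun z => f' (cube_uncons z).2)) => [z z1|].
      by rewrite -{2}(cube_unconsK z) [cube_uncons z]surjective_pairing cube_uncons_head z1 g1.
    apply: continuous_continuous_on; first exact: face_closed.
    exact: (comp_continuous ctail cf').
  + apply: (@eq_continuous_on _ _ _ (fun=> x)) => [z bz|].
      by rewrite -(cube_unconsK z) [X in cube_cons X]surjective_pairing gx.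
    apply: continuous_continuous_on; last exact: constant_continuous.
    apply: (@continuous_preimage_closed _ _ _ (@cube_boundary R n) ctail).
    exact: cube_boundary_closed.
- exact: (comp_continuous (@cube_uncons_continuous R n) ch).
- move=> z; rewrite -(cube_unconsK z); case: cube_uncons => s t.
  rewrite cube_cons_boundary /= cube_consK => -[[->|->]|bt].
  + by rewrite g0 h0.
  + by rewrite g1 h1.
  + by rewrite gx ?hx.
exists (G \o @cube_cons R n); split=> [|t|t|s t bt] /=.
- exact: (comp_continuous (@cube_cons_continuous R n)).
- by rewrite Gg ?g0 //; apply/cube_cons_boundary; left; left.
- by rewrite Gg ?g1 //; apply/cube_cons_boundary; left; right.
- by rewrite Gg ?gx //; apply/cube_cons_boundary; right.
Qed.

(** Injectivity lifts a homotopy by a cylinder, over the 0-cube for path components. For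
    surjectivity a spheroid in [B] is lifted relative to the constant boundary [x], so that its
    image is the spheroid itself. *)
Lemma sphere_filling_weak_equivalence :
  continuous p -> (forall y, exists x, p x = y) -> @sphere_filling R E B p ->
  weak_equivalence R p.
Proof.
move=> cp surj sph.
have b0 (t : cube 0) : ~ cube_boundary t by case=> -[].
pose t0 : cube 0 := fun=> i0 R.
split=> // [|n x n0].
  split=> [x x' [c [cc c0 c1]]|y].
  have [||||||||G [cG G0 G1 _]] :=
    @sphere_filling_cylinder 0 (fun=> x) (fun=> x') x (c \o fst) sph => //.
  + exact: constant_continuous.
  + exact: constant_continuous.
  + by move=> t /b0.
  + exact: (comp_continuous fst_continuous cc).
  + by move=> s t /b0.
  exists (fun s => G (s, t0)); split=> //.
  apply: (@comp_continuous _ _ _ (fun s => (s, t0)) G _ cG).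
  by apply: continuous_pair; [move=> s; exact: cvg_id|exact: constant_continuous].
  have [x xy] := surj y.
  exists x, (fun=> y); split=> //; exact: constant_continuous.
split=> [f f' [cf fx] [cf' f'x]|g [cg gx]].
  move=> [H [cH H0 H1 Hb]].
  have {}cH := homotopy_continuous (compact_hausdorff_cube R n) cH.
  have [||||||||G [cG G0 G1 Gb]] := @sphere_filling_cylinder n f f' x H sph => //.
    by move=> s t bt; rewrite Hb //= fx.
  exists G; split=> // [|s t bt]; last by rewrite Gb ?fx.
  exact: (@comp_continuous (kify (I * cube n)%type) (I * cube n)%type E
        (fun z => z) G kify_id_continuous cG).
- have [|||G [cG Gx pG]] := sph n (fun=> x) g.
  + apply: continuous_continuous_on; first exact: cube_boundary_closed.
    exact: constant_continuous.
  + exact: cg.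
  + by move=> t /gx.
  exists G => //; exists (g \o snd); split=> [|t|t|s t bt] //=.
  exact: (@comp_continuous (kify (I * cube n)%type) (I * cube n)%type B
        (fun z => z) (g \o snd) kify_id_continuous (comp_continuous snd_continuous cg)).
Qed.

End Converse.

(** * The space of fillings *)

Section ParametrizedFilling.
Context {R : realType} {Y E B : topologicalType}.
Local Notation I := (unit_interval R).
Local Notation cube := (cube R).
Variables (p : E -> B) (k : nat).
Variables (b : Y -> cube k -> E) (h : Y -> cube k -> B).

Hypothesis b_continuous : forall (K : topologicalType) (u : K -> Y),
  compact_hausdorff K -> continuous u ->
  continuous_on [set z : K * cube k | cube_boundary z.2] (fun z => b (u z.1) z.2).
Hypothesis h_continuous : forall (K : topologicalType) (u : K -> Y),
  compact_hausdorff K -> continuous u ->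
  continuous (fun z : K * cube k => h (u z.1) z.2).
Hypothesis pbh : forall y t, cube_boundary t -> p (b y t) = h y t.

(** Continuity of the cube is a condition here because the compact-open type contains all
    functions. *)
Definition fillings : set (Y * {compact-open, cube k -> E}) :=
  [set z | [/\ continuous (z.2 : cube k -> E),
               forall t, cube_boundary t -> z.2 t = b z.1 t &
               forall t, p (z.2 t) = h z.1 t]].

(** k-ified because cofibrancy is tested against CGWH total spaces only. *)
Definition filling_space : topologicalType := kify (set_type fillings).

Definition filling_base (x : filling_space) : Y := (set_val (x : set_type fillings)).1.

Definition filling_cube (x : filling_space) : cube k -> E :=
  (set_val (x : set_type fillings)).2.

Lemma filling_cubeP x : [/\ continuous (filling_cube x),
  forall t, cube_boundary t -> filling_cube x t = b (filling_base x) t &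
  forall t, p (filling_cube x t) = h (filling_base x) t].
Proof. exact: (set_valP (x : set_type fillings)). Qed.

Lemma filling_val_continuous :
  continuous (fun x : filling_space => set_val (x : set_type fillings)).
Proof.
exact: (@comp_continuous filling_space (set_type fillings) _ (fun x => x) set_val
  kify_id_continuous set_val_continuous).
Qed.

Lemma filling_base_continuous : continuous filling_base.
Proof. exact: (comp_continuous filling_val_continuous fst_continuous). Qed.

Lemma filling_cube_continuous (K : topologicalType) (u : K -> filling_space) :
  continuous u -> continuous (fun z : K * cube k => filling_cube (u z.1) z.2).
Proof.
move=> cu; apply: (@continuous_uncurry_compact K (cube k) E (fun x => filling_cube (u x))).
- exact: compact_hausdorff_cube.
- exact: (comp_continuous (comp_continuous cu filling_val_continuous) snd_continuous).
- by move=> x; have [] := filling_cubeP (u x).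
Qed.

Lemma filling_space_continuous (K : topologicalType) (u : K -> filling_space) :
  compact_hausdorff K -> continuous (filling_base \o u) ->
  continuous (fun z : K * cube k => filling_cube (u z.1) z.2) -> continuous u.
Proof.
move=> hK cb cc; apply: continuous_into_kify => //.
apply: set_type_continuous.
pose c x : {compact-open, cube k -> E} := filling_cube (u x).
rewrite (_ : _ \o _ = fun x => (filling_base (u x), c x)); last first.
  by apply/funext => x; exact: surjective_pairing.
apply: continuous_pair => //.
exact: (@continuous_curry_compact K (cube k) E (fun x => filling_cube (u x))).
Qed.

Lemma make_filling (y : Y) (c : cube k -> E) :
  continuous c -> (forall t, cube_boundary t -> c t = b y t) ->
  (forall t, p (c t) = h y t) ->
  exists x : filling_space, filling_base x = y /\ filling_cube x = c.
Proof.
move=> cc cb pc.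
have F : fillings (y, c : {compact-open, cube k -> E}) by [].
by exists (SigSub (mem_set F)).
Qed.

(** The fillings are chosen point by point. Continuity is not lost, since the base and the cube of
    each chosen filling are the prescribed ones and currying [c] is continuous. *)
Lemma make_filling_map (K : topologicalType) (v : K -> Y) (c : K * cube k -> E) :
  compact_hausdorff K -> continuous v -> continuous c ->
  (forall z, cube_boundary z.2 -> c z = b (v z.1) z.2) ->
  (forall z, p (c z) = h (v z.1) z.2) ->
  exists u : K -> filling_space, [/\ continuous u,
    forall x, filling_base (u x) = v x & forall x t, filling_cube (u x) t = c (x, t)].
Proof.
move=> hK cv cc cb pc.
have [|u uP] := @boolp.choice _ _ (fun (x : K) (w : filling_space) =>
    filling_base w = v x /\ filling_cube w = fun t => c (x, t)).
  move=> x; apply: make_filling => [|t bt|t]; [|by rewrite cb|by rewrite pc].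
  apply: (@comp_continuous _ _ _ (fun t => (x, t)) c _ cc).
  by apply: continuous_pair; [exact: constant_continuous|move=> t; exact: cvg_id].
have uc x t : filling_cube (u x) t = c (x, t) by have [_ ->] := uP x.
exists u; split=> //; last by move=> x; have [] := uP x.
apply: filling_space_continuous => //.
  by rewrite (_ : _ \o _ = v) //; apply/funext => x; have [] := uP x.
by rewrite (_ : (fun z => _) = c) //; apply/funext => -[x t]; rewrite uc.
Qed.

Lemma filling_space_inj (x x' : filling_space) :
  filling_base x = filling_base x' -> filling_cube x = filling_cube x' -> x = x'.
Proof.
move=> eb ec; apply: (@set_val_inj _ fillings).
by apply: injective_projections.
Qed.

(** The base ([None]) and the evaluations at the points [t] of the cube ([Some t]) are continuous
    and jointly injective. *)
Lemma filling_space_cgwh : weakly_hausdorff Y -> weakly_hausdorff E -> cgwh filling_space.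
Proof.
move=> wY wE; split; first exact: kify_compactly_generated.
apply: (@weakly_hausdorff_joint filling_space (option (cube k))
  (fun o => if o is Some _ then E else Y)
  (fun o => if o is Some t return filling_space -> (if o is Some _ then E else Y)
            then filling_cube^~ t else filling_base)).
- case=> [t|]; last exact: filling_base_continuous.
  exact: (@comp_continuous filling_space {compact-open, cube k -> E} E
    filling_cube (fun c => c t)
    (comp_continuous filling_val_continuous snd_continuous)
    (@compact_open_eval_continuous (cube k) E t)).
- by case.
- move=> x x' e; apply: filling_space_inj; first exact: (e None).
  by apply/funext => t; exact: (e (Some t)).
Qed.

(** Uncurried, the initial fillings live on the bottom of [(D * cube k) * I] and the data [b] on the
    sides. They agree on the overlap because a filling restricts to [b], which leaves a collar
    problem for [p]. *)
Lemma filling_base_covering_homotopy :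
  @covering_homotopy R E B p -> @covering_homotopy R filling_space Y filling_base.
Proof.
move=> hlp D cD g f cg cf bgf.
have hD := compact_hausdorff_cubical cD.
have hDI := compact_hausdorff_prod hD (compact_hausdorff_unit_interval R).
pose flip (z : (D * cube k) * I) : (D * I) * cube k := ((z.1.1, z.2), z.1.2).
pose flop (z : (D * I) * cube k) : (D * cube k) * I := ((z.1.1, z.2), z.1.2).
have cflip : continuous flip.
  apply: continuous_pair; last exact: (comp_continuous fst_continuous snd_continuous).
  apply: continuous_pair; last exact: snd_continuous.
  exact: (comp_continuous fst_continuous fst_continuous).
have cflop : continuous flop.
  apply: continuous_pair; last exact: (comp_continuous fst_continuous snd_continuous).
  apply: continuous_pair; last exact: snd_continuous.
  exact: (comp_continuous fst_continuous fst_continuous).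
pose g0 (d : D) := g (d, i0 R).
have cg0 : continuous g0.
  apply: continuous_onT.
  apply: (@continuous_on_comp _ _ _ _ _ (fun d => (d, i0 R)) g _ _ _ cg) => //.
  by apply: continuous_pair; [move=> d; exact: cvg_id|exact: constant_continuous].
have bg0 d : filling_base (g0 d) = f (d, i0 R) by rewrite /g0 bgf.
pose G (z : (D * cube k) * I) :=
  if z.2 == i0 R then filling_cube (g0 z.1.1) z.1.2 else b (f (z.1.1, z.2)) z.1.2.
have G0 z : z.2 = i0 R -> G z = filling_cube (g0 z.1.1) z.1.2.
  by rewrite /G => ->; rewrite eqxx.
have Gb z : cube_boundary z.1.2 -> G z = b (f (z.1.1, z.2)) z.1.2.
  rewrite /G; case: eqP => // -> bt.
  by have [_ -> //] := filling_cubeP (g0 z.1.1); rewrite bg0.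
have [|||H [cH HG pH]] := prod_cube_collar_lifts (n := k) hlp cD
    (g := G) (h := fun z => h (f (z.1.1, z.2)) z.1.2).
- have -> : [set z : (D * cube k) * I | z.2 = i0 R \/ cube_boundary z.1.2] =
    [set z | z.2 = i0 R] `|` [set z | cube_boundary z.1.2] by [].
  apply: continuous_onU.
    apply: (@eq_continuous_on _ _ _ (fun z => filling_cube (g0 z.1.1) z.1.2)).
      by move=> z /G0 ->.
    apply: continuous_continuous_on; first exact: bottom_closed.
    apply: (@comp_continuous _ _ _ fst (fun z => filling_cube (g0 z.1) z.2)).
      exact: fst_continuous.
    exact: filling_cube_continuous.
  apply: (@eq_continuous_on _ _ _
    ((fun z => b (f z.1) z.2) \o flip)) => [z bz|]; first by rewrite Gb.
  apply: (continuous_on_comp _ cflip _ (b_continuous hDI cf)) => //.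
  apply: (@continuous_preimage_closed _ _ (fun z : (D * cube k) * I => z.1.2)
    (@cube_boundary R k)).
    exact: (comp_continuous fst_continuous snd_continuous).
  exact: cube_boundary_closed.
- exact: (comp_continuous cflip (h_continuous hDI cf)).
- move=> z [z0|bz]; last by rewrite Gb // pbh.
  by rewrite G0 //; have [_ _ ->] := filling_cubeP (g0 z.1.1); rewrite bg0 z0.
have [|||u [cu ub uc]] := @make_filling_map _ f (H \o flop) hDI cf.
- exact: comp_continuous.
- by move=> [[d s] t] bt; rewrite /= HG /= ?Gb //; right.
- by move=> [[d s] t]; rewrite /= pH.
exists u; split=> // -[d s] /= s0; apply: filling_space_inj; first by rewrite ub bgf.
apply/funext => t; rewrite uc /= HG /=; last by left.
by rewrite G0 //= /g0 s0.
Qed.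

(** Under [cube_join], the set where the sphere of fillings or the data [b] prescribe a value is
    exactly the boundary of the [(m + k)]-cube. *)
Lemma filling_base_sphere_filling :
  @sphere_filling R E B p -> @sphere_filling R filling_space Y filling_base.
Proof.
move=> sph m g f cg cf bgf.
have hm := compact_hausdorff_cube R m; have hk := compact_hausdorff_cube R k.
have cbm := @cube_boundary_closed R m; have cbk := @cube_boundary_closed R k.
pose A := [set z : cube m * cube k | cube_boundary z.1].
pose A' := [set z : cube m * cube k | cube_boundary z.2].
pose G (z : cube m * cube k) :=
  if asbool (cube_boundary z.1) then filling_cube (g z.1) z.2 else b (f z.1) z.2.
have GA z : A z -> G z = filling_cube (g z.1) z.2.
  by rewrite /G => Az; case: asboolP.
have GA' z : A' z -> G z = b (f z.1) z.2.
  rewrite /G => A'z; case: asboolP => // bz.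
  by have [_ -> //] := filling_cubeP (g z.1); rewrite bgf.
have fill : lifts p (A `|` A').
  apply: (@lifts_transport _ _ p _ (cube (m + k)) _ (@cube_boundary R (m + k))
    (@cube_join R m k) (@cube_split R m k)).
  - exact: cube_boundary_closed.
  - exact: cube_join_continuous.
  - exact: cube_split_continuous.
  - exact: cube_joinK.
  - by move=> t; rewrite -{1}(cube_splitK t) cube_join_boundary.
  - by move=> z Az; apply/cube_join_boundary.
  - exact: sph.
have [|||H [cH HG pH]] := fill G (fun z => h (f z.1) z.2).
- apply: continuous_onU.
    apply: (@eq_continuous_on _ _ _ (fun z => filling_cube (g z.1) z.2)).
      by move=> z /GA ->.
    apply: (@continuous_on_uncurry _ _ _ _ (fun x => filling_cube (g x))) => //.
    exact: (filling_cube_continuous (continuous_on_set_val cg)).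
  apply: (@eq_continuous_on _ _ _ (fun z => b (f z.1) z.2)).
    by move=> z /GA' ->.
  exact: b_continuous.
- exact: h_continuous.
- move=> z [Az|A'z]; last by rewrite GA' // pbh.
  by rewrite GA //; have [_ _ ->] := filling_cubeP (g z.1); rewrite bgf.
have [||u [cu ub uc]] := @make_filling_map _ f H hm cf cH => //.
- by move=> z bz; rewrite HG ?GA' //; right.
exists u; split=> // t bt; apply: filling_space_inj; first by rewrite ub bgf.
by apply/funext => s; rewrite uc HG ?GA //; left.
Qed.

Lemma filling_base_surjective y :
  @sphere_filling R E B p -> exists x, filling_base x = y.
Proof.
move=> sph.
have hI := compact_hausdorff_unit_interval R.
(* The constant path at [y] is a compact Hausdorff parameter space through which the continuity
   hypotheses yield the data at the single point [y]. *)
have cy : continuous (fun _ : I => y) by exact: constant_continuous.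
have cin : continuous (fun t : cube k => (i0 R, t)).
  by apply: continuous_pair; [exact: constant_continuous|move=> t; exact: cvg_id].
have [|||c [cc cb pc]] := sph k (b y) (h y).
- apply: (continuous_on_comp _ cin _ (b_continuous hI cy)) => //.
  exact: cube_boundary_closed.
- exact: (comp_continuous cin (h_continuous hI cy)).
- by move=> t; exact: pbh.
by have [x [xy _]] := make_filling cc cb pc; exists x.
Qed.

Lemma parametrized_filling :
  cgwh Y -> serre_cofibrant R Y -> weakly_hausdorff E ->
  @covering_homotopy R E B p -> @sphere_filling R E B p ->
  exists c : Y -> cube k -> E, [/\
    forall (K : topologicalType) (u : K -> Y), compact_hausdorff K ->
      continuous u -> continuous (fun z : K * cube k => c (u z.1) z.2),
    forall y t, cube_boundary t -> c y t = b y t &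
    forall y t, p (c y t) = h y t].
Proof.
move=> gY cY wE hlp sph.
have [|||||s cs sK] := cY filling_space Y filling_base _ _ _ _ (fun y => y).
- by apply: filling_space_cgwh => //; case: gY.
- exact: gY.
- apply: covering_homotopy_serre; first exact: filling_base_continuous.
  exact: filling_base_covering_homotopy.
- apply: sphere_filling_weak_equivalence; first exact: filling_base_continuous.
    by move=> y; exact: filling_base_surjective.
  exact: filling_base_sphere_filling.
- by move=> y; exact: cvg_id.
exists (fun y => filling_cube (s y)); split=> [K u hK cu|y t bt|y t].
- exact: (filling_cube_continuous (comp_continuous cu cs)).
- by have [_ -> //] := filling_cubeP (s y); rewrite sK.
- by have [_ _ ->] := filling_cubeP (s y); rewrite sK.
Qed.

End ParametrizedFilling.

(** * Restriction along the axes of a power *)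

Section Morphisms.
Context {T : leftLinearTheory}.

Lemma mapsp_weakly_hausdorff (A B : T) : weakly_hausdorff (mapsp A B).
Proof. by have [] := mapsp_cgwh A B. Qed.

Lemma cmp_continuous_compact (A B C : T) (K : topologicalType)
    (f : K -> mapsp B C) (g : K -> mapsp A B) :
  compact_hausdorff K -> continuous f -> continuous g ->
  continuous (fun x => cmp (f x) (g x)).
Proof.
move=> hK cf cg.
apply: (@comp_continuous K (kify (mapsp B C * mapsp A B)%type) _
  (fun x => (f x, g x)) (fun z => cmp z.1 z.2)); last exact: cmp_continuous.
by apply: continuous_into_kify => //; exact: continuous_pair.
Qed.

Lemma madd_continuous_compact (A B : T) (K : topologicalType)
    (f g : K -> mapsp A B) :
  compact_hausdorff K -> continuous f -> continuous g ->
  continuous (fun x => madd (f x) (g x)).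
Proof.
move=> hK cf cg.
apply: (@comp_continuous K (kify (mapsp A B * mapsp A B)%type) _
  (fun x => (f x, g x)) (fun z => madd z.1 z.2)); last exact: madd_continuous.
by apply: continuous_into_kify => //; exact: continuous_pair.
Qed.

Lemma pairing_continuous_compact (J : finType) (A : J -> T) (X : T)
    (K : topologicalType) (x : K -> forall j, mapsp X (A j)) :
  compact_hausdorff K -> (forall j, continuous (fun k => x k j)) ->
  continuous (fun k => pairing A (x k)).
Proof.
move=> hK cx.
apply: (@comp_continuous K (kify (prod_topology (fun j => mapsp X (A j)))) _
  x (fun y => pairing A y)); last exact: pairing_continuous.
by apply: continuous_into_kify => //; exact: ptws_continuous.
Qed.

Lemma precomp_continuous (A B C : T) (y : mapsp A B) :
  continuous (fun x : mapsp B C => cmp x y).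
Proof.
have [gBC _] := mapsp_cgwh B C.
apply: (continuous_compactly_generated gBC) => K u hK cu.
by apply: cmp_continuous_compact => //; exact: constant_continuous.
Qed.

Lemma fprod_ext (J : finType) (A : J -> T) (X : T) (y y' : mapsp X (Defs.fprod A)) :
  (forall j, cmp (fproj A j) y = cmp (fproj A j) y') -> y = y'.
Proof.
move=> yy'; rewrite -(pairing_fproj y) -(pairing_fproj y').
by congr pairing; apply: functional_extensionality_dep.
Qed.

Lemma pairing_cmp (J : finType) (A : J -> T) (X Y : T)
    (x : forall j, mapsp X (A j)) (y : mapsp Y X) :
  cmp (pairing A x) y = pairing A (fun j => cmp (x j) y).
Proof. by apply: fprod_ext => j; rewrite cmpA !fproj_pairing. Qed.

End Morphisms.

Section Restriction.
Context {R : realType} {T : leftLinearTheory}.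

Definition npower (n : nat) (A : T) : T := Defs.fprod (fun _ : 'I_n => A).

Definition axis n (A : T) (k : 'I_n) : mapsp A (npower n A) :=
  pairing (fun _ : 'I_n => A) (fun i => if i == k then idm A else point).

Definition nrestrict n (A Z : T) (f : mapsp (npower n A) Z) :
  {ptws 'I_n -> mapsp A Z} := fun k => cmp f (axis A k).

Definition npower_cons n (A : T) : mapsp (binprod A (npower n A)) (npower n.+1 A) :=
  pairing (fun _ : 'I_n.+1 => A)
    (fun i => if unlift ord0 i is Some j
              then cmp (fproj (fun _ : 'I_n => A) j)
                       (fproj (fun b : bool => if b then A else npower n A) false)
              else fproj (fun b : bool => if b then A else npower n A) true).

Definition npower_uncons n (A : T) : mapsp (npower n.+1 A) (binprod A (npower n A)) :=
  pairing (fun b : bool => if b then A else npower n A)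
    (fun b => if b return mapsp _ (if b then A else npower n A)
              then fproj (fun _ : 'I_n.+1 => A) ord0
              else pairing (fun _ : 'I_n => A)
                     (fun j => fproj (fun _ : 'I_n.+1 => A) (lift ord0 j))).

Lemma binprod_fproj_pairing (A B X : T)
    (x : forall b : bool, mapsp X (if b then A else B)) (b : bool) :
  cmp (fproj (fun b : bool => if b then A else B) b : mapsp _ (if b then A else B))
    (pairing (fun b : bool => if b then A else B) x) = x b.
Proof. exact: (@fproj_pairing _ _ (fun b : bool => if b then A else B)). Qed.

Lemma npower_uncons_fst n A :
  cmp (fproj (fun b : bool => if b then A else npower n A) true : mapsp _ A)
    (npower_uncons n A) = fproj (fun _ : 'I_n.+1 => A) ord0.
Proof. exact: (binprod_fproj_pairing _ true). Qed.

Lemma npower_uncons_snd n A :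
  cmp (fproj (fun b : bool => if b then A else npower n A) false : mapsp _ (npower n A))
    (npower_uncons n A) =
  pairing (fun _ : 'I_n => A) (fun j => fproj (fun _ : 'I_n.+1 => A) (lift ord0 j)).
Proof. exact: (binprod_fproj_pairing _ false). Qed.

Lemma npower_unconsK n A : cmp (npower_cons n A) (npower_uncons n A) = idm _.
Proof.
apply: fprod_ext => i; rewrite cmpm1 cmpA fproj_pairing.
case: unliftP => [j|] ->; last by rewrite npower_uncons_fst.
by rewrite -cmpA npower_uncons_snd fproj_pairing.
Qed.

Lemma binprod_ext (A B X : T) (y y' : mapsp X (binprod A B)) :
  cmp (fproj (fun b : bool => if b then A else B) true : mapsp _ A) y =
  cmp (fproj (fun b : bool => if b then A else B) true : mapsp _ A) y' ->
  cmp (fproj (fun b : bool => if b then A else B) false : mapsp _ B) y =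
  cmp (fproj (fun b : bool => if b then A else B) false : mapsp _ B) y' ->
  y = y'.
Proof. by move=> et ef; apply: fprod_ext => -[]. Qed.

Lemma incl_l_fst (A B : T) :
  cmp (fproj (fun b : bool => if b then A else B) true : mapsp _ A) (incl_l A B) = idm A.
Proof. exact: (binprod_fproj_pairing _ true). Qed.

Lemma incl_l_snd (A B : T) :
  cmp (fproj (fun b : bool => if b then A else B) false : mapsp _ B) (incl_l A B) = point.
Proof. exact: (binprod_fproj_pairing _ false). Qed.

Lemma incl_r_fst (A B : T) :
  cmp (fproj (fun b : bool => if b then A else B) true : mapsp _ A) (incl_r A B) = point.
Proof. exact: (binprod_fproj_pairing _ true). Qed.

Lemma incl_r_snd (A B : T) :
  cmp (fproj (fun b : bool => if b then A else B) false : mapsp _ B) (incl_r A B) = idm B.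
Proof. exact: (binprod_fproj_pairing _ false). Qed.

Lemma fproj_axis n (A : T) (i k : 'I_n) :
  cmp (fproj (fun _ : 'I_n => A) i) (axis A k) = if i == k then idm A else point.
Proof. exact: fproj_pairing. Qed.

Lemma npower_uncons_head n A :
  cmp (npower_uncons n A) (axis A ord0) = incl_l A (npower n A).
Proof.
apply: binprod_ext; rewrite cmpA.
  by rewrite npower_uncons_fst incl_l_fst fproj_axis.
rewrite npower_uncons_snd incl_l_snd; apply: fprod_ext => j.
by rewrite cmpA fproj_pairing fproj_axis cmpm0 eq_sym (negPf (neq_lift _ _)).
Qed.

Lemma npower_uncons_tail n A (j : 'I_n) :
  cmp (npower_uncons n A) (axis A (lift ord0 j)) =
  cmp (incl_r A (npower n A)) (axis A j).
Proof.
apply: binprod_ext; rewrite !cmpA.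
  by rewrite npower_uncons_fst incl_r_fst fproj_axis cmp0m (negPf (neq_lift _ _)).
rewrite npower_uncons_snd incl_r_snd cmp1m; apply: fprod_ext => i.
by rewrite cmpA fproj_pairing !fproj_axis (inj_eq lift_inj).
Qed.

Lemma npower0_terminal (A X : T) (y y' : mapsp X (npower 0 A)) : y = y'.
Proof. by apply: fprod_ext => -[]. Qed.

(** Induction along the splitting of [A^{n+1}] as [A] times [A^n]: a lift is found for [A^n], then
    for the binary restriction. Compactness of [D] makes the pair of data continuous into the
    k-ified product. *)
Lemma nrestrict_lifts (D : topologicalType) (S : set D) :
  compact_hausdorff D -> (forall A B Z : T, lifts (@Defs.restrict T A B Z) S) ->
  forall n (A Z : T), lifts (@nrestrict n A Z) S.
Proof.
move=> hD lS; elim=> [|n IHn] A Z g h cg ch gh.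
  (* [A^0] is terminal, so its identity is 0, and so is every morphism out of it. *)
  have f0 (f : mapsp (npower 0 A) Z) : f = point.
    by rewrite -(cmpm1 f) (npower0_terminal (idm _) point) cmpm0.
  exists (fun=> point); split=> [|d _|d]; first exact: constant_continuous.
    exact/esym/f0.
  by apply/funext => -[].
have c0 : continuous (fun d => h d ord0).
  exact: (@ptws_coord_continuous _ (fun _ : 'I_n.+1 => mapsp A Z) _ h ord0 ch).
pose tail d : {ptws 'I_n -> mapsp A Z} := fun j => h d (lift ord0 j).
have ctail : continuous tail.
  apply: ptws_continuous => j.
  exact: (@ptws_coord_continuous _ (fun _ : 'I_n.+1 => mapsp A Z) _ h _ ch).
have consl : cmp (npower_cons n A) (incl_l A (npower n A)) = axis A ord0.
  by rewrite -npower_uncons_head cmpA npower_unconsK cmp1m.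
have consr j : cmp (npower_cons n A) (cmp (incl_r A (npower n A)) (axis A j)) =
    axis A (lift ord0 j).
  by rewrite -npower_uncons_tail cmpA npower_unconsK cmp1m.
(* [G'] is the future restriction of the lift to [A^n]. Constructed first, it completes [h d ord0]
   to a pair over which the binary restriction can be lifted. *)
have [|||G' [cG' G'g rG']] :=
  IHn A Z (fun d => cmp (cmp (g d) (npower_cons n A)) (incl_r A (npower n A))) tail.
- apply: (continuous_comp_on _ (@precomp_continuous _ _ _ _ (incl_r A (npower n A)))).
  exact: (continuous_comp_on cg (@precomp_continuous _ _ _ _ (npower_cons n A))).
- exact: ctail.
- move=> d Sd; apply/funext => j; rewrite /nrestrict -!cmpA consr.
  exact: (congr1 (fun f : {ptws 'I_n.+1 -> mapsp A Z} => f (lift ord0 j)) (gh d Sd)).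
have [|||G [cG Gg rG]] := lS A (npower n A) Z
    (fun d => cmp (g d) (npower_cons n A)) (fun d => (h d ord0, G' d)).
- exact: (continuous_comp_on cg (@precomp_continuous _ _ _ _ (npower_cons n A))).
- by apply: continuous_into_kify => //; exact: continuous_pair.
- move=> d Sd; rewrite /Defs.restrict G'g // -cmpA consl.
  congr pair.
  exact: (congr1 (fun f : {ptws 'I_n.+1 -> mapsp A Z} => f ord0) (gh d Sd)).
exists (fun d => cmp (G d) (npower_uncons n A)); split=> [|d Sd|d].
- exact: (comp_continuous cG (@precomp_continuous _ _ _ _ (npower_uncons n A))).
- by rewrite Gg // -cmpA npower_unconsK cmpm1.
apply/funext => i; rewrite /nrestrict -cmpA.
have [j|] := unliftP ord0 i => ->.
  rewrite npower_uncons_tail cmpA.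
  rewrite (congr1 snd (rG d) : cmp (G d) (incl_r A (npower n A)) = G' d).
  exact: (congr1 (fun f : {ptws 'I_n -> mapsp A Z} => f j) (rG' d)).
rewrite npower_uncons_head.
exact: (congr1 fst (rG d)).
Qed.

Hypothesis bilinear : weakly_bilinear R T.

Lemma nrestrict_covering_homotopy n (A Z : T) :
  @covering_homotopy R _ _ (@nrestrict n A Z).
Proof.
move=> D cD; apply: nrestrict_lifts => [|A' B' Z'].
  exact: (compact_hausdorff_cubical (cubical_prod cD (@cubical_interval R))).
by have [fib _] := bilinear A' B' Z'; exact: serre_covering_homotopy.
Qed.

Lemma nrestrict_sphere_filling n (A Z : T) :
  @sphere_filling R _ _ (@nrestrict n A Z).
Proof.
move=> m; apply: nrestrict_lifts => [|A' B' Z'].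
  exact: compact_hausdorff_cube.
have [fib weq] := bilinear A' B' Z'.
exact: (weak_equivalence_sphere_filling (serre_covering_homotopy fib)).
Qed.

Lemma nrestrict_filling n (A Z : T) (Y : topologicalType) k
    (b : Y -> cube R k -> mapsp (npower n A) Z)
    (h : Y -> cube R k -> {ptws 'I_n -> mapsp A Z}) :
  cgwh Y -> serre_cofibrant R Y ->
  (forall (K : topologicalType) (u : K -> Y), compact_hausdorff K -> continuous u ->
     continuous_on [set z : K * cube R k | cube_boundary z.2]
       (fun z => b (u z.1) z.2)) ->
  (forall (K : topologicalType) (u : K -> Y), compact_hausdorff K -> continuous u ->
     continuous (fun z : K * cube R k => h (u z.1) z.2)) ->
  (forall y t, cube_boundary t -> nrestrict (b y t) = h y t) ->
  exists c : Y -> cube R k -> mapsp (npower n A) Z, [/\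
    forall (K : topologicalType) (u : K -> Y), compact_hausdorff K ->
      continuous u -> continuous (fun z : K * cube R k => c (u z.1) z.2),
    forall y t, cube_boundary t -> c y t = b y t &
    forall y t, nrestrict (c y t) = h y t].
Proof.
move=> gY cY cb ch bh; apply: parametrized_filling => //.
- exact: mapsp_weakly_hausdorff.
- exact: nrestrict_covering_homotopy.
- exact: nrestrict_sphere_filling.
Qed.

End Restriction.

(** * Distributors *)

Section NatIndexed.
Context {R : realType} {T : leftLinearTheory} {n : nat}.
Local Notation I := (unit_interval R).
Variable phi : distributor R T n.
Implicit Types (A B X Y : T).

(* Indexing by [nat] instead of ordinals turns the face equations into
   identities between plain sequences; only the initial segments matter. *)
Definition ndist m {A B X} (a : mapsp A B) (x : nat -> mapsp X A) (t : nat -> I) :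
  mapsp X B := dist phi m a (fun i => x i) (fun i => t i).

Definition nadd {A X} (x : nat -> mapsp X A) (j : nat) : nat -> mapsp X A :=
  fun i => if (i < j)%N then x i
           else if i == j then madd (x i) (x i.+1) else x i.+1.

Definition nskip (t : nat -> I) (j : nat) : nat -> I := fun i => t (bump j i).

Definition nshift {S : Type} (x : nat -> S) (j : nat) : nat -> S :=
  fun i => x (j + i)%N.

Lemma eq_ndist m A B X (a : mapsp A B) (x y : nat -> mapsp X A) (t s : nat -> I) :
  (forall i, (i <= m)%N -> x i = y i) -> (forall i, (i < m)%N -> t i = s i) ->
  ndist m a x t = ndist m a y s.
Proof.
move=> xy ts; congr (dist phi m a _ _); apply/funext => i.
  by rewrite xy // -ltnS.
by rewrite ts.
Qed.

Lemma nadd_lt A X (x : nat -> mapsp X A) j i : (i < j)%N -> nadd x j i = x i.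
Proof. by rewrite /nadd => ->. Qed.

Lemma nadd_eq A X (x : nat -> mapsp X A) j : nadd x j j = madd (x j) (x j.+1).
Proof. by rewrite /nadd ltnn eqxx. Qed.

Lemma nadd_gt A X (x : nat -> mapsp X A) j i : (j < i)%N -> nadd x j i = x i.+1.
Proof. by rewrite /nadd; case: ltngtP. Qed.

(** The case with content is [i = l = j], where three consecutive entries are merged and
    associativity of [madd] is used. *)
Lemma naddC A X (x : nat -> mapsp X A) j l i :
  (j <= l)%N -> nadd (nadd x j) l i = nadd (nadd x l.+1) j i.
Proof.
move=> jl; case: (ltngtP i l) => [il|il|->{i}].
- rewrite nadd_lt //; case: (ltngtP i j) => [ij|ij|ij].
  + by rewrite !nadd_lt // ltnS ltnW.
  + by rewrite !(nadd_gt _ ij) nadd_lt.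
  + by rewrite ij in il *; rewrite !nadd_eq !nadd_lt // ltnW.
- by rewrite !nadd_gt //; lia.
- rewrite nadd_eq; have [lj|lj] := ltnP j l.
    by rewrite [RHS](nadd_gt _ lj) nadd_eq !nadd_gt //; lia.
  have -> : l = j by lia.
  by rewrite !nadd_eq nadd_gt // nadd_lt // maddA.
Qed.

Lemma ndist_face0 m A B X (a : mapsp A B) (x : nat -> mapsp X A) (t : nat -> I) j :
  (m <= n)%N -> (j < m)%N -> t j = i0 R ->
  ndist m a x t = ndist m.-1 a (nadd x j) (nskip t j).
Proof.
case: m => // m mn jm tj.
rewrite /ndist (@dist_face0 _ _ _ phi _ _ _ _ _ _ (Ordinal (jm : (j < m.+1)%N))) //=.
congr (dist phi m a _ _); apply/funext => i //=.
have im := ltn_ord i.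
rewrite /add_adjacent /nadd -val_eqE /= !inordK //; lia.
Qed.

Lemma ndist_face1 m A B X (a : mapsp A B) (x : nat -> mapsp X A) (t : nat -> I) j :
  (m <= n)%N -> (j < m)%N -> t j = i1 R ->
  ndist m a x t =
  madd (ndist j a x t) (ndist (m.-1 - j) a (nshift x j.+1) (nshift t j.+1)).
Proof.
case: m => // m mn jm tj.
rewrite /ndist (@dist_face1 _ _ _ phi _ _ _ _ _ _ (Ordinal (jm : (j < m.+1)%N))) //=.
congr (madd _ _); [congr (dist phi j a _ _)|congr (dist phi (m - j) a _ _)];
  apply/funext => i; rewrite /nshift ?inordK //; have := ltn_ord i; lia.
Qed.

(** The last coordinate is set to 0, so the appended entry 0 is added to [x m] and disappears.
    Universality and the wedge condition, required only in degree [n], thereby reach the lower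
    degrees. *)
Lemma ndist_pad m A B X (a : mapsp A B) (x : nat -> mapsp X A) (t : nat -> I) :
  (m < n)%N ->
  ndist m a x t = ndist m.+1 a (fun i => if (i <= m)%N then x i else point)
                               (fun i => if (i < m)%N then t i else i0 R).
Proof.
move=> mn; rewrite (@ndist_face0 m.+1 _ _ _ _ _ _ m) ?ltnn //=.
apply: eq_ndist => i im; last first.
  by rewrite /nskip (_ : bump m i = i) ?im //; rewrite /bump leqNgt im.
rewrite /nadd /= im; case: (ltngtP i m) im => // -> _.
by rewrite maddm0.
Qed.

Lemma ndist_continuous m A B X (K : topologicalType) (a : K -> mapsp A B)
    (x : K -> nat -> mapsp X A) (t : K -> nat -> I) :
  (m <= n)%N -> compact_hausdorff K -> continuous a ->
  (forall i, continuous (fun k => x k i)) ->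
  (forall i, continuous (fun k => t k i)) ->
  continuous (fun k => ndist m (a k) (x k) (t k)).
Proof.
move=> mn hK ca cx ct.
pose f (k : K) : {compact-open, cube R m -> mapsp X B} :=
  dist phi m (a k) (fun i : 'I_m.+1 => x k i).
have cf : continuous f.
  apply: (@comp_continuous K (kify (mapsp A B * {ptws 'I_m.+1 -> mapsp X A})%type)
    {compact-open, cube R m -> mapsp X B}
    (fun k => (a k, (fun i : 'I_m.+1 => x k i) : {ptws 'I_m.+1 -> mapsp X A}))
    (fun z => dist phi m z.1 z.2 : {compact-open, cube R m -> mapsp X B}));
    last exact: dist_continuous.
  apply: continuous_into_kify => //; apply: continuous_pair => //.
  exact: ptws_continuous.
have {}cf := continuous_uncurry_compact (compact_hausdorff_cube R m) cf
  (fun k => dist_cube (a := a k) (x := fun i : 'I_m.+1 => x k i) mn).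
apply: (@comp_continuous _ _ _ (fun k => (k, (fun i : 'I_m => t k i) : cube R m)) _ _ cf).
apply: continuous_pair; first by move=> k; exact: cvg_id.
by apply: cube_continuous => i; exact: ct.
Qed.

Hypothesis phi_good : good phi.

Lemma dist_natural A B X Y (a : mapsp A B) (x : 'I_n.+1 -> mapsp X A)
    (z : mapsp Y X) t :
  cmp (dist phi n a x t) z = dist phi n a (fun i => cmp (x i) z) t.
Proof.
have [univ _] := phi_good.
by rewrite univ -cmpA pairing_cmp [RHS]univ.
Qed.

(** Downward induction from degree [n]: padding inserts zeros, and composition preserves them. *)
Lemma ndist_natural m A B X Y (a : mapsp A B) (x : nat -> mapsp X A)
    (z : mapsp Y X) (t : nat -> I) :
  (m <= n)%N -> cmp (ndist m a x t) z = ndist m a (fun i => cmp (x i) z) t.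
Proof.
move=> mn; move: x t; rewrite -(subKn mn).
elim: (n - m)%N (leq_subr m n) => [|k IH] kn x t.
  by rewrite subn0; exact: dist_natural.
have e : (n - k = (n - k.+1).+1)%N by lia.
rewrite ndist_pad; last lia.
rewrite -e IH ?(ltnW kn) // [RHS]ndist_pad; last lia.
rewrite -e; apply: eq_ndist => i _ //.
by case: ifP => // _; rewrite cmp0m.
Qed.

Definition wedge {A X} (x : mapsp X A) (k : nat) : nat -> mapsp X A :=
  fun i => if i == k then x else point.

Lemma ndist_wedge m A B X (a : mapsp A B) (x : mapsp X A) k (t : nat -> I) :
  (m <= n)%N -> (k <= m)%N -> ndist m a (wedge x k) t = cmp a x.
Proof.
move=> mn; move: k t; rewrite -(subKn mn).
elim: (n - m)%N (leq_subr m n) => [|l IH] ln k t; rewrite ?subn0 => kn.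
  have [_ /(_ A B X a x (Ordinal (kn : (k < n.+1)%N)) (fun i => t i)) <-] := phi_good.
  by congr (dist phi n a _ _).
have e : (n - l = (n - l.+1).+1)%N by lia.
rewrite ndist_pad -?e; last lia.
rewrite -[RHS](IH _ k (fun i => if (i < n - l.+1)%N then t i else i0 R)); try lia.
apply: eq_ndist => i _ //; rewrite /wedge.
by case: leqP => // ni; case: eqP => // ik; lia.
Qed.

(** The zero tuple is the wedge of [x = 0], and [a0 = 0]. *)
Lemma ndist0 m A B X (a : mapsp A B) (t : nat -> I) :
  (m <= n)%N -> ndist m a (fun=> point : mapsp X A) t = point.
Proof.
move=> mn; rewrite -[RHS](@cmpm0 T X A B a) -(@ndist_wedge m _ _ _ _ _ 0 t) //.
by apply: eq_ndist => i _ //; rewrite /wedge; case: ifP.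
Qed.

End NatIndexed.

(** * The boundary of the cube to be filled *)

Section Faces.
Context {R : realType} {T : leftLinearTheory} {n : nat}.
Local Notation I := (unit_interval R).
Variable phi : distributor R T n.
Implicit Types (A B X Y : T).

Definition iend (e : bool) : I := if e then i1 R else i0 R.

(** The right-hand sides of the face equations for an [n.+1]-distributor based on [phi]; they only
    involve degrees at most [n]. *)
Definition face (e : bool) (j : nat) {A B X} (a : mapsp A B) (x : nat -> mapsp X A)
    (t : nat -> I) : mapsp X B :=
  if e then madd (ndist phi j a x t)
                 (ndist phi (n - j) a (nshift x j.+1) (nshift t j.+1))
  else ndist phi n a (nadd x j) (nskip t j).

(** Each side is expanded by the face equation of [phi] for the other coordinate; removing
    coordinate [j] renumbers [j'] as [j'.-1]. Two ends 1 give a sum of three terms and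
    associativity, two ends 0 give [naddC], and the mixed cases compare index by index. *)
Lemma face_compatible e e' j j' A B X (a : mapsp A B) (x : nat -> mapsp X A)
    (t : nat -> I) :
  (j < j')%N -> (j' <= n)%N -> t j = iend e -> t j' = iend e' ->
  face e j a x t = face e' j' a x t.
Proof.
move=> jj' j'n tj tj'.
have j'1 : j'.-1.+1 = j' by rewrite prednK //; lia.
have skip_j' : nskip t j j'.-1 = iend e'.
  by rewrite /nskip (_ : bump j j'.-1 = j') // /bump; lia.
have skip_j : nskip t j' j = iend e.
  by rewrite /nskip (_ : bump j' j = j) // /bump; lia.
have shift_j' : nshift t j.+1 (j' - j.+1)%N = iend e' by rewrite /nshift subnKC.
rewrite /face; case: e tj skip_j => tj skip_j;
  case: e' tj' skip_j' shift_j' => tj' skip_j' shift_j'.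
- rewrite (@ndist_face1 _ _ _ phi (n - j) _ _ _ _ _ _ (j' - j.+1)) //; try lia.
  rewrite (@ndist_face1 _ _ _ phi j' _ _ _ _ _ _ j) //; try lia.
  rewrite maddA.
  have -> : (j'.-1 - j = j' - j.+1)%N by lia.
  have -> : ((n - j).-1 - (j' - j.+1) = n - j')%N by lia.
  congr (madd _ _); apply: eq_ndist => i _; rewrite /nshift; congr (_ _); lia.
- rewrite (@ndist_face0 _ _ _ phi (n - j) _ _ _ _ _ _ (j' - j.+1)) //; try lia.
  rewrite (@ndist_face1 _ _ _ phi n _ _ _ _ _ _ j) //; try lia.
  have -> : ((n - j).-1 = n.-1 - j)%N by lia.
  congr (madd _ _); apply: eq_ndist => i ij.
  + by rewrite nadd_lt //; lia.
  + by rewrite /nskip (_ : bump j' i = i) // /bump; lia.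
  + rewrite /nadd /nshift.
    have -> : (i < j' - j.+1)%N = (j.+1 + i < j')%N by lia.
    have -> : (i == j' - j.+1)%N = (j.+1 + i == j')%N by lia.
    by rewrite !addnS.
  + by rewrite /nskip /nshift /bump; congr (t _); lia.
- rewrite (@ndist_face1 _ _ _ phi n _ _ _ _ _ _ j'.-1) //; try lia.
  rewrite (@ndist_face0 _ _ _ phi j' _ _ _ _ _ _ j) //; try lia.
  have -> : (n.-1 - j'.-1 = n - j')%N by lia.
  rewrite j'1; congr (madd _ _); apply: eq_ndist => i _.
    by rewrite /nshift nadd_gt //; lia.
  by rewrite /nskip /nshift (_ : bump j (j' + i) = (j' + i).+1) // /bump; lia.
- rewrite (@ndist_face0 _ _ _ phi n _ _ _ _ _ _ j'.-1) //; try lia.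
  rewrite [RHS](@ndist_face0 _ _ _ phi n _ _ _ _ _ _ j) //; try lia.
  apply: eq_ndist => i _; first by rewrite -{2}j'1 naddC //; lia.
  by rewrite /nskip /bump; congr (t _); lia.
Qed.

Lemma face_continuous e j A B X (K : topologicalType) (a : K -> mapsp A B)
    (x : K -> nat -> mapsp X A) (t : K -> nat -> I) :
  (j <= n)%N -> compact_hausdorff K -> continuous a ->
  (forall i, continuous (fun k => x k i)) ->
  (forall i, continuous (fun k => t k i)) ->
  continuous (fun k => face e j (a k) (x k) (t k)).
Proof.
move=> jn hK ca cx ct; rewrite /face; case: e.
  apply: madd_continuous_compact => //; first exact: ndist_continuous.
  by apply: ndist_continuous => // [|i|i]; [exact: leq_subr|exact: cx|exact: ct].
apply: ndist_continuous => // i; last exact: ct.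
rewrite /nadd; case: (i < j)%N => //; case: (i == j) => //.
exact: madd_continuous_compact.
Qed.

Hypothesis phi_good : good phi.

Lemma face_natural e j A B X Y (a : mapsp A B) (x : nat -> mapsp X A)
    (z : mapsp Y X) (t : nat -> I) :
  (j <= n)%N -> cmp (face e j a x t) z = face e j a (fun i => cmp (x i) z) t.
Proof.
move=> jn; rewrite /face; case: e.
  by rewrite cmpDl !ndist_natural ?leq_subr.
rewrite ndist_natural //; apply: eq_ndist => i _ //; rewrite /nadd.
by case: ifP => // _; case: ifP => // _; rewrite cmpDl.
Qed.

(** At the end 1 the nonzero entry falls into one summand, and the other summand vanishes by
    [ndist0]. At the end 0 the merged tuple is again a wedge. *)
Lemma face_wedge e j A B X (a : mapsp A B) (x : mapsp X A) k (t : nat -> I) :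
  (j <= n)%N -> (k <= n.+1)%N -> face e j a (wedge x k) t = cmp a x.
Proof.
move=> jn kn; rewrite /face; case: e; last first.
  rewrite -[RHS](@ndist_wedge _ _ _ phi phi_good n _ _ _ a x
    (* Merging the entries [j] and [j.+1] shifts every position after [j] down by one. *)
    (if (k <= j)%N then k else k.-1) (nskip t j)) //; last by case: (leqP k j); lia.
  apply: eq_ndist => i _ //; rewrite /nadd /wedge.
  case: (ltngtP i j) => [ij|ij|->].
  - by case: (leqP k j) => kj; congr (if _ then _ else _); lia.
  - by case: (leqP k j) => kj; congr (if _ then _ else _); lia.
  - case: (leqP k j) => kj.
      by rewrite (_ : (j.+1 == k) = false) ?maddm0 //; lia.
    rewrite (_ : (j == k) = false) ?madd0m; last lia.
    by congr (if _ then _ else _); lia.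
have [kj|jk] := leqP k j.
  rewrite ndist_wedge // -[RHS]maddm0; congr madd.
  rewrite -[RHS](@ndist0 _ _ _ phi phi_good (n - j) _ _ _ a (nshift t j.+1)) ?leq_subr //.
  by apply: eq_ndist => i _ //; rewrite /nshift /wedge; case: eqP => //; lia.
rewrite -[RHS]madd0m; congr madd.
  rewrite -[RHS](@ndist0 _ _ _ phi phi_good j _ _ _ a t) //.
  by apply: eq_ndist => i ij //; rewrite /wedge; case: eqP => //; lia.
rewrite -[RHS](@ndist_wedge _ _ _ phi phi_good (n - j) _ _ _ a x
  (k - j.+1) (nshift t j.+1)) ?leq_subr //; last lia.
apply: eq_ndist => i _ //; rewrite /nshift /wedge.
by congr (if _ then _ else _); lia.
Qed.

(** An arbitrary face through [t] is picked; [face_compatible] makes the choice irrelevant. Off the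
    boundary the value is a default. *)
Definition boundary_value {A B X} (a : mapsp A B) (x : nat -> mapsp X A)
    (t : nat -> I) : mapsp X B :=
  if [pick j : 'I_n.+1 | (t j == i0 R) || (t j == i1 R)] is Some j
  then face (t j == i1 R) j a x t else point.

Lemma boundary_valueE e j A B X (a : mapsp A B) (x : nat -> mapsp X A) (t : nat -> I) :
  (j <= n)%N -> t j = iend e -> boundary_value a x t = face e j a x t.
Proof.
move=> jn tj; rewrite /boundary_value; case: pickP => [j' tj'|none]; last first.
  have := none (Ordinal (jn : (j < n.+1)%N)); rewrite /= tj.
  by case: (e); rewrite /= eqxx ?orbT.
have {}tj' : t j' = iend (t j' == i1 R).
  by case/orP: tj' => /eqP ->; rewrite /iend ?eqxx //; case: eqP => // /i0_neq_i1.
move: (t j' == i1 R) tj' => e' tj'.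
have [jj'|jj'|ejj'] := ltngtP j j'.
- by apply/esym; apply: face_compatible => //; rewrite -ltnS.
- exact: face_compatible.
- rewrite ejj' in tj *.
  have -> // : e' = e.
  move: tj; rewrite tj'; case: e' e {tj'} => -[] //= e01.
    by have := i0_neq_i1 (esym e01).
  by have := i0_neq_i1 e01.
Qed.

End Faces.

Definition seq_of_fun {S : Type} (s0 : S) m (f : 'I_m -> S) : nat -> S :=
  fun i => if insub i is Some j then f j else s0.

Lemma seq_of_funE (S : Type) (s0 : S) m (f : 'I_m -> S) (j : 'I_m) :
  seq_of_fun s0 f j = f j.
Proof. by rewrite /seq_of_fun valK. Qed.

Lemma seq_of_fun_inord (S : Type) (s0 : S) m (f : 'I_m.+1 -> S) i :
  (i < m.+1)%N -> seq_of_fun s0 f i = f (inord i).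
Proof. by move=> im; rewrite -(seq_of_funE s0 f (inord i)) inordK. Qed.

Section Projections.
Context {T : leftLinearTheory}.

Definition projections m (A : T) : nat -> mapsp (npower m A) A :=
  seq_of_fun point (fproj (fun _ : 'I_m => A)).

Lemma projections_pairing m (A X : T) (x : 'I_m -> mapsp X A) i :
  cmp (projections m A i) (pairing (fun _ : 'I_m => A) x) = seq_of_fun point x i.
Proof.
rewrite /projections /seq_of_fun; case: insub => [j|]; last exact: cmp0m.
exact: fproj_pairing.
Qed.

Lemma projections_axis m (A : T) (k : 'I_m) i :
  cmp (projections m A i) (axis A k) = wedge (idm A) k i.
Proof.
rewrite projections_pairing /wedge /seq_of_fun; case: insubP => [j _ <-//|].
by rewrite -leqNgt; case: eqP => // ->; rewrite leqNgt ltn_ord.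
Qed.

Lemma pairing_fproj_id m (A : T) :
  pairing (fun _ : 'I_m => A) (fproj (fun _ : 'I_m => A)) = idm (npower m A).
Proof. by apply: fprod_ext => j; rewrite fproj_pairing cmpm1. Qed.

Lemma pairing_wedge m (A X : T) (x : mapsp X A) (k : 'I_m) :
  pairing (fun _ : 'I_m => A) (fun i => if i == k then x else point) = cmp (axis A k) x.
Proof.
rewrite pairing_cmp; congr pairing; apply/funext => i.
by case: ifP; rewrite ?cmp1m ?cmp0m.
Qed.

End Projections.

(** * Existence: extending an [n]-distributor to degree [n.+1] *)

Section Existence.
Context {R : realType} {T : leftLinearTheory} {n : nat}.
Local Notation I := (unit_interval R).
Local Notation cube := (cube R).
Variable phi' : distributor R T n.
Hypothesis bilinear : weakly_bilinear R T.
Hypothesis cofibrant : forall A B : T, serre_cofibrant R (mapsp A B).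
Hypothesis phi'_good : good phi'.
Implicit Types (A B X : T).

Definition cube_seq m (t : cube m) : nat -> I := seq_of_fun (i0 R) t.

Lemma cube_seq_continuous m i : continuous (fun t : cube m => cube_seq t i).
Proof.
rewrite /cube_seq /seq_of_fun; case: insub => [j|]; last exact: constant_continuous.
exact: (@ptws_proj_continuous _ (fun _ : 'I_m => I)).
Qed.

Lemma cube_boundary_end m (t : cube m.+1) :
  cube_boundary t <-> exists e j, (j <= m)%N /\ cube_seq t j = iend e.
Proof.
split=> [[j [tj|tj]]|[e [j [jm tj]]]].
- by exists false, j; split; [rewrite -ltnS|rewrite /cube_seq seq_of_funE].
- by exists true, j; split; [rewrite -ltnS|rewrite /cube_seq seq_of_funE].
exists (Ordinal (jm : (j < m.+1)%N)); rewrite -(seq_of_funE (i0 R) t) /= -/(cube_seq t) tj.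
by case: (e); [right|left].
Qed.

(** The guard [m = n.+1] lets [filling] be defined in every degree, so that [ext_dist] can use it at
    a variable [m] without casts. *)
Definition universal_filling m A B (c : mapsp A B -> cube m -> mapsp (npower m.+1 A) B) :=
  m = n.+1 -> [/\
    forall (K : topologicalType) (u : K -> mapsp A B), compact_hausdorff K ->
      continuous u -> continuous (fun z : K * cube m => c (u z.1) z.2),
    forall a t, cube_boundary t ->
      c a t = boundary_value phi' a (projections m.+1 A) (cube_seq t) &
    forall a t k, cmp (c a t) (axis A k) = a].

(** The boundary is a finite union of closed faces, and on each of them the value is given by one
    fixed continuous [face]. *)
Lemma boundary_continuous A B (K : topologicalType) (u : K -> mapsp A B) :
  compact_hausdorff K -> continuous u ->
  continuous_on [set z : K * cube n.+1 | cube_boundary z.2]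
    (fun z => boundary_value phi' (u z.1) (projections n.+2 A) (cube_seq z.2)).
Proof.
move=> hK cu.
pose F (ej : bool * 'I_n.+1) := [set z : K * cube n.+1 | cube_seq z.2 ej.2 = iend ej.1].
have -> : [set z : K * cube n.+1 | cube_boundary z.2] = \bigcup_ej F ej.
  apply/seteqP; split=> z /=.
    move=> /cube_boundary_end[e [j [jn zj]]].
    by exists (e, Ordinal (jn : (j < n.+1)%N)).
  move=> [[e j] _ zj]; apply/cube_boundary_end; exists e, j; split=> //.
  by rewrite -ltnS.
have hKC := compact_hausdorff_prod hK (compact_hausdorff_cube R n.+1).
have cs i : continuous (fun z : K * cube n.+1 => cube_seq z.2 i).
  exact: (comp_continuous snd_continuous (@cube_seq_continuous n.+1 i)).
apply: continuous_on_bigcup => -[e j].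
apply: (@eq_continuous_on _ _ _
  (fun z => face phi' e j (u z.1) (projections n.+2 A) (cube_seq z.2))).
  by move=> z zj; rewrite (boundary_valueE _ _ _ _ zj) // -ltnS.
apply: continuous_continuous_on.
  apply: (@continuous_preimage_closed _ _ (fun z : K * cube n.+1 => cube_seq z.2 j)
    [set iend e]) => //.
  exact: unit_interval_closed1.
apply: face_continuous => //.
- by rewrite -ltnS.
- exact: (comp_continuous fst_continuous cu).
- by move=> i; exact: constant_continuous.
Qed.

Lemma universal_filling_exists m A B : exists c, @universal_filling m A B c.
Proof.
have [->|mn] := pselect (m = n.+1); last by exists (fun _ _ => point).
have [|||c [cc cb ca]] := @nrestrict_filling R T bilinear n.+2 A B (mapsp A B) n.+1
    (fun a t => boundary_value phi' a (projections n.+2 A) (cube_seq t))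
    (fun a _ _ => a) (mapsp_cgwh A B) (@cofibrant A B).
- exact: boundary_continuous.
- move=> K u hK cu; apply: ptws_continuous => k.
  exact: (comp_continuous fst_continuous cu).
(* Precomposing with the axis [k] turns the projections into the wedge of [idm A] at [k], so
   [face_natural] and [face_wedge] give [a]. *)
- move=> a t /cube_boundary_end[e [j [jn tj]]]; apply/funext => k.
  rewrite /nrestrict (boundary_valueE _ _ _ jn tj) face_natural //.
  rewrite -[RHS]cmpm1 -(face_wedge phi'_good e a (idm A) (cube_seq t) jn
    (k := k)); last by rewrite -ltnS.
  by congr (face _ _ _ _ _); apply/funext => i; exact: projections_axis.
exists c => _; split=> // a t k.
exact: (congr1 (fun f : {ptws 'I_n.+2 -> mapsp A B} => f k) (ca a t)).
Qed.

Definition filling m A B := sval (cid (@universal_filling_exists m A B)).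

Lemma filling_continuous A B (K : topologicalType) (u : K -> mapsp A B) :
  compact_hausdorff K -> continuous u ->
  continuous (fun z : K * cube n.+1 => filling (u z.1) z.2).
Proof. by rewrite /filling; case: cid => c /= [//|+ _ _]; apply. Qed.

Lemma filling_boundary A B (a : mapsp A B) (t : cube n.+1) :
  cube_boundary t ->
  filling a t = boundary_value phi' a (projections n.+2 A) (cube_seq t).
Proof. by rewrite /filling; case: cid => c /= [//|_ + _]; apply. Qed.

Lemma filling_axis A B (a : mapsp A B) (t : cube n.+1) k :
  cmp (filling a t) (axis A k) = a.
Proof. by rewrite /filling; case: cid => c /= [//|_ _ +]; apply. Qed.

Definition ext_dist m A B X (a : mapsp A B) (x : 'I_m.+1 -> mapsp X A) (t : cube m) :
  mapsp X B :=
  if (m <= n)%N then dist phi' m a x t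
  else cmp (filling a t) (pairing (fun _ : 'I_m.+1 => A) x).

Lemma ext_dist_low m A B X (a : mapsp A B) (x : 'I_m.+1 -> mapsp X A) (t : cube m) :
  (m <= n)%N -> ext_dist a x t = dist phi' m a x t.
Proof. by rewrite /ext_dist => ->. Qed.

Lemma ext_dist_top A B X (a : mapsp A B) (x : 'I_n.+2 -> mapsp X A) (t : cube n.+1) :
  ext_dist a x t = cmp (filling a t) (pairing (fun _ : 'I_n.+2 => A) x).
Proof. by rewrite /ext_dist ltnn. Qed.

(** The boundary is prescribed for the projections only; naturality of [face] carries it to
    arbitrary [x]. *)
Lemma ext_dist_face e j A B X (a : mapsp A B) (x : 'I_n.+2 -> mapsp X A)
    (t : cube n.+1) :
  (j <= n)%N -> cube_seq t j = iend e ->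
  ext_dist a x t = face phi' e j a (seq_of_fun point x) (cube_seq t).
Proof.
move=> jn tj; rewrite ext_dist_top filling_boundary; last first.
  by apply/cube_boundary_end; exists e, j.
rewrite (boundary_valueE _ _ _ jn tj) face_natural //.
by congr (face _ _ _ _ _); apply/funext => i; exact: projections_pairing.
Qed.

Lemma ext_dist_cube m A B X (a : mapsp A B) (x : 'I_m.+1 -> mapsp X A) :
  (m <= n.+1)%N -> continuous (ext_dist a x).
Proof.
rewrite leq_eqVlt ltnS => /orP[/eqP mn|mn]; last first.
  have -> : ext_dist a x = dist phi' m a x.
    by apply/funext => t; exact: ext_dist_low.
  exact: dist_cube.
move: x; rewrite mn => x.
have -> : ext_dist a x = fun t => cmp (filling a t) (pairing (fun _ => A) x).
  by apply/funext => t; exact: ext_dist_top.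
have hC := compact_hausdorff_cube R n.+1.
apply: cmp_continuous_compact => //; last exact: constant_continuous.
apply: (@comp_continuous _ _ _ (fun t : cube n.+1 => (t, t))
  (fun z => filling a z.2)).
  by apply: continuous_pair => t; exact: cvg_id.
by apply: filling_continuous => //; exact: constant_continuous.
Qed.

Lemma ext_dist_continuous m A B X :
  (m <= n.+1)%N ->
  continuous (fun z : kify (mapsp A B * {ptws 'I_m.+1 -> mapsp X A})%type =>
                ext_dist z.1 z.2 : {compact-open, cube m -> mapsp X B}).
Proof.
rewrite leq_eqVlt ltnS => /orP[/eqP ->|mn]; last first.
  rewrite (_ : (fun z => _) = fun z => dist phi' m z.1 z.2); last first.
    by apply/funext => z; apply/funext => t; exact: ext_dist_low.
  exact: dist_continuous.
apply: continuous_kify => K u hK cu.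
apply: (@continuous_curry_compact K (cube n.+1) (mapsp X B)
  (fun k => ext_dist (u k).1 (u k).2)).
rewrite (_ : (fun z => _) = fun z : K * cube n.+1 =>
  cmp (filling (u z.1).1 z.2) (pairing (fun _ => A) (u z.1).2)); last first.
  by apply/funext => z; exact: ext_dist_top.
have hKC := compact_hausdorff_prod hK (compact_hausdorff_cube R n.+1).
apply: cmp_continuous_compact => //.
  by apply: (@filling_continuous _ _ _ (fst \o u)) => //;
    exact: (comp_continuous cu fst_continuous).
apply: pairing_continuous_compact => // i.
apply: (@ptws_coord_continuous _ (fun _ : 'I_n.+2 => mapsp X A) _ (fun z => (u z.1).2) i).
exact: (comp_continuous fst_continuous (comp_continuous cu snd_continuous)).
Qed.

Lemma ext_dist_base A B X (a : mapsp A B) (x : 'I_1 -> mapsp X A) (t : cube 0) :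
  ext_dist a x t = cmp a (x ord0).
Proof. by rewrite ext_dist_low // dist_base. Qed.

Lemma ext_dist_face0 m A B X (a : mapsp A B) (x : 'I_m.+2 -> mapsp X A)
    (j : 'I_m.+1) (t : cube m.+1) :
  (m.+1 <= n.+1)%N -> t j = i0 R ->
  ext_dist a x t = ext_dist a (add_adjacent x j) (fun i : 'I_m => t (lift j i)).
Proof.
rewrite ltnS => mn tj; rewrite [RHS]ext_dist_low //.
move: mn; rewrite leq_eqVlt => /orP[/eqP mn|mn]; last first.
  by rewrite ext_dist_low // (dist_face0 _ _ _ mn tj).
move: x j t tj; rewrite mn => x j t tj.
have jn : (j <= n)%N by rewrite -ltnS.
rewrite (@ext_dist_face false j) ?/cube_seq ?seq_of_funE // /face.
congr (dist phi' n a _ _); apply/funext => i.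
  have iS := ltn_ord i; rewrite /add_adjacent /nadd -val_eqE /=.
  by rewrite !seq_of_fun_inord //; lia.
by rewrite /nskip -(seq_of_funE (i0 R)).
Qed.

Lemma ext_dist_face1 m A B X (a : mapsp A B) (x : 'I_m.+2 -> mapsp X A)
    (j : 'I_m.+1) (t : cube m.+1) :
  (m.+1 <= n.+1)%N -> t j = i1 R ->
  ext_dist a x t =
    madd (ext_dist a (fun i : 'I_j.+1 => x (inord i)) (fun i : 'I_j => t (inord i)))
         (ext_dist a (fun i : 'I_(m - j).+1 => x (inord (j.+1 + i)%N))
                     (fun i : 'I_(m - j) => t (inord (j.+1 + i)%N))).
Proof.
rewrite ltnS => mn tj.
have jm : (j <= m)%N by rewrite -ltnS.
rewrite [ext_dist a (fun i : 'I_j.+1 => _) _]ext_dist_low; last exact: leq_trans mn.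
rewrite [ext_dist a (fun i : 'I_(m - j).+1 => _) _]ext_dist_low; last first.
  exact: leq_trans (leq_subr _ _) mn.
move: mn; rewrite leq_eqVlt => /orP[/eqP mn|mn]; last first.
  by rewrite ext_dist_low // (dist_face1 _ _ _ mn tj).
move: x j t tj jm; rewrite mn => x j t tj jn.
rewrite (@ext_dist_face true j) ?/cube_seq ?seq_of_funE // /face.
congr (madd _ _); [congr (dist phi' j a _ _)|congr (dist phi' (n - j) a _ _)];
  apply/funext => i; rewrite /nshift seq_of_fun_inord //; have := ltn_ord i; lia.
Qed.

Definition extension : distributor R T n.+1 :=
  Distributor ext_dist_cube ext_dist_continuous ext_dist_base
    ext_dist_face0 ext_dist_face1.

Lemma extension_good : good extension.
Proof.
split=> [A B X a x t|A B X a x k t] /=; rewrite !ext_dist_top.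
  by rewrite pairing_fproj_id cmpm1.
by rewrite pairing_wedge cmpA filling_axis.
Qed.

Lemma extension_based_on : based_on extension phi'.
Proof. by move=> m A B X a x t mn; exact: ext_dist_low. Qed.

End Existence.

(** * Uniqueness up to homotopy relative to the boundary *)

Section Uniqueness.
Context {R : realType} {T : leftLinearTheory} {n : nat}.
Local Notation I := (unit_interval R).
Local Notation cube := (cube R).
Variables (phi' : distributor R T n) (phi psi : distributor R T n.+1).
Hypothesis bilinear : weakly_bilinear R T.
Hypothesis cofibrant : forall A B : T, serre_cofibrant R (mapsp A B).
Hypotheses (phi_good : good phi) (phi_based : based_on phi phi').
Hypotheses (psi_good : good psi) (psi_based : based_on psi phi').
Implicit Types (A B X : T).

Lemma based_on_boundary A B X (a : mapsp A B) (x : 'I_n.+2 -> mapsp X A)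
    (t : cube n.+1) :
  cube_boundary t -> dist phi n.+1 a x t = dist psi n.+1 a x t.
Proof.
move=> [j [tj|tj]].
  rewrite (@dist_face0 _ _ _ phi _ _ _ _ _ _ j) // (@dist_face0 _ _ _ psi _ _ _ _ _ _ j) //.
  by rewrite phi_based // psi_based.
have jn : (j <= n)%N by rewrite -ltnS.
rewrite (@dist_face1 _ _ _ phi _ _ _ _ _ _ j) // (@dist_face1 _ _ _ psi _ _ _ _ _ _ j) //.
by rewrite !phi_based ?psi_based //= leq_subr.
Qed.

Lemma universal_cube_continuous (theta : distributor R T n.+1) A B
    (K : topologicalType) (u : K -> mapsp A B) :
  compact_hausdorff K -> continuous u ->
  continuous (fun z : K * cube n.+1 =>
    dist theta n.+1 (u z.1) (fproj (fun _ : 'I_n.+2 => A)) z.2).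
Proof.
move=> hK cu.
have hKC := compact_hausdorff_prod hK (compact_hausdorff_cube R n.+1).
rewrite (_ : (fun z => _) = fun z =>
    ndist theta n.+1 (u z.1) (projections n.+2 A) (cube_seq z.2)); last first.
  apply/funext => z; rewrite /ndist; congr (dist theta n.+1 _ _ _);
    by apply/funext => i; rewrite ?/projections ?/cube_seq seq_of_funE.
apply: ndist_continuous => //.
- exact: (comp_continuous fst_continuous cu).
- by move=> i; exact: constant_continuous.
- by move=> i; exact: (comp_continuous snd_continuous (@cube_seq_continuous R n.+1 i)).
Qed.

(** Universality read backwards turns the composite into the cube of a wedge of the identity. Hence
    the universal cubes of [phi] and [psi] lie over the same constant map, and so can a homotopy
    between them. *)
Lemma universal_cube_axis (theta : distributor R T n.+1) A B (a : mapsp A B) t k :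
  good theta ->
  cmp (dist theta n.+1 a (fproj (fun _ : 'I_n.+2 => A)) t) (axis A k) = a.
Proof.
move=> gtheta; have [univ w] := gtheta.
by rewrite -univ w cmpm1.
Qed.

(** Boundary data for the homotopy, with time as first coordinate. On the sides [phi] is used for
    every time before the end, which is consistent with [psi] at the end by [based_on_boundary]. *)
Definition end_cubes A B (a : mapsp A B) (z : cube n.+2) : mapsp (npower n.+2 A) B :=
  let: (s, t) := cube_uncons z in
  if s == i1 R then dist psi n.+1 a (fproj (fun _ : 'I_n.+2 => A)) t
  else dist phi n.+1 a (fproj (fun _ : 'I_n.+2 => A)) t.

Lemma end_cubesE A B (a : mapsp A B) s t : end_cubes a (cube_cons (s, t)) =
  if s == i1 R then dist psi n.+1 a (fproj (fun _ : 'I_n.+2 => A)) t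
  else dist phi n.+1 a (fproj (fun _ : 'I_n.+2 => A)) t.
Proof. by rewrite /end_cubes cube_consK. Qed.

Lemma end_cubes_continuous A B (K : topologicalType) (u : K -> mapsp A B) :
  compact_hausdorff K -> continuous u ->
  continuous_on [set z : K * cube n.+2 | cube_boundary z.2]
    (fun z => end_cubes (u z.1) z.2).
Proof.
move=> hK cu.
pose P (theta : distributor R T n.+1) (z : K * cube n.+2) :=
  dist theta n.+1 (u z.1) (fproj (fun _ : 'I_n.+2 => A)) (cube_uncons z.2).2.
have cP theta : continuous (P theta).
  apply: (@comp_continuous _ _ _ (fun z : K * cube n.+2 => (z.1, (cube_uncons z.2).2)) _ _
    (@universal_cube_continuous theta A B K u hK cu)).
  apply: continuous_pair; first exact: fst_continuous.
  exact: (comp_continuous (comp_continuous snd_continuous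
    (@cube_uncons_continuous R n.+1)) snd_continuous).
have cside : continuous (fun z : K * cube n.+2 => (cube_uncons z.2).2).
  exact: (comp_continuous (comp_continuous snd_continuous
    (@cube_uncons_continuous R n.+1)) snd_continuous).
pose S1 := [set z : K * cube n.+2 | z.2 ord0 = i1 R].
pose S0 := [set z : K * cube n.+2 | z.2 ord0 = i0 R].
pose S := [set z : K * cube n.+2 | cube_boundary (cube_uncons z.2).2].
have clS s : closed [set z : K * cube n.+2 | z.2 ord0 = s].
  exact: (continuous_preimage_closed snd_continuous (@face_closed R n.+1 s)).
have PE z : end_cubes (u z.1) z.2 = if z.2 ord0 == i1 R then P psi z else P phi z.
  by rewrite -{1}(cube_unconsK z.2) [X in cube_cons X]surjective_pairing end_cubesE.
have -> : [set z : K * cube n.+2 | cube_boundary z.2] = (S0 `|` S1) `|` S.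
  apply/seteqP; split=> -[k z]; rewrite -(cube_unconsK z); case: cube_uncons => s t;
    by rewrite /S /S0 /S1 /= cube_cons_boundary /= cube_cons_head
      (congr1 snd (cube_consK (s, t)) : (fun j => _) = _).
apply: continuous_onU; first apply: continuous_onU.
- apply: (@eq_continuous_on _ _ _ (P phi)) => [z z0|].
    by rewrite PE z0; case: eqP => // /i0_neq_i1.
  by apply: continuous_continuous_on => //; exact: clS.
- apply: (@eq_continuous_on _ _ _ (P psi)) => [z z1|].
    by rewrite PE z1 eqxx.
  by apply: continuous_continuous_on => //; exact: clS.
- apply: (@eq_continuous_on _ _ _ (P phi)) => [z bz|].
    by rewrite PE; case: ifP => // _; exact: based_on_boundary.
  apply: continuous_continuous_on => //.
  exact: (continuous_preimage_closed cside (@cube_boundary_closed R n.+1)).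
Qed.

(** The universal cubes are joined by a filling [c] of [end_cubes]; composing with the tuple [x]
    transports this homotopy to every [X], since both distributors are universal. *)
Lemma good_distributors_homotopic X A B :
  homotopic_rel R (@top_boundary R T n.+1 X A B)
    (@top_map R T n.+1 X A B phi) (@top_map R T n.+1 X A B psi).
Proof.
have [|||c [cc cb ca]] := @nrestrict_filling R T bilinear n.+2 A B (mapsp A B) n.+2
    (@end_cubes A B) (fun a _ _ => a) (mapsp_cgwh A B) (@cofibrant A B).
- exact: end_cubes_continuous.
- move=> K u hK cu; apply: ptws_continuous => k.
  exact: (comp_continuous fst_continuous cu).
- move=> a z _; apply/funext => k; rewrite /nrestrict /end_cubes.
  by case: cube_uncons => s t; case: ifP => _; exact: universal_cube_axis.
have [univ_phi _] := phi_good; have [univ_psi _] := psi_good.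
exists (fun z : kify (I * top_domain R n.+1 X A B)%type =>
  cmp (c z.2.1.2 (cube_cons (z.1, z.2.1.1))) (pairing (fun _ : 'I_n.+2 => A) z.2.2)).
split=> [|p|p|s p bp].
- apply: continuous_kify => K u hK cu.
  have cs : continuous (fun k => (u k).1) := comp_continuous cu fst_continuous.
  have cd : continuous (fun k => (u k).2 : cube n.+1 * mapsp A B * {ptws 'I_n.+2 -> mapsp X A}).
    exact: (@comp_continuous K (top_domain R n.+1 X A B)
      (cube n.+1 * mapsp A B * {ptws 'I_n.+2 -> mapsp X A})%type (fun k => (u k).2)
      (fun z => z) (comp_continuous cu snd_continuous) kify_id_continuous).
  have cta := comp_continuous cd fst_continuous.
  apply: cmp_continuous_compact => //.
    apply: (@comp_continuous _ _ _
      (fun k => (k, cube_cons ((u k).1, (u k).2.1.1)))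
      (fun z => c (u z.1).2.1.2 z.2)); last first.
      by apply: (cc K (fun k => (u k).2.1.2)) => //;
        exact: (comp_continuous cta snd_continuous).
    apply: continuous_pair; first by move=> k; exact: cvg_id.
    apply: (comp_continuous _ (@cube_cons_continuous R n.+1)).
    by apply: continuous_pair => //; exact: (comp_continuous cta fst_continuous).
  apply: pairing_continuous_compact => // i.
  apply: (@ptws_coord_continuous _ (fun _ : 'I_n.+2 => mapsp X A) _ (fun k => (u k).2.2) i).
  exact: (comp_continuous cd snd_continuous).
- rewrite /= cb; last by apply/cube_cons_boundary; left; left.
  rewrite end_cubesE; case: eqP => [/i0_neq_i1//|_].
  by rewrite -univ_phi.
- rewrite /= cb; last by apply/cube_cons_boundary; left; right.
  by rewrite end_cubesE eqxx -univ_psi.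
- rewrite /= cb; last by apply/cube_cons_boundary; right.
  rewrite end_cubesE -based_on_boundary //.
  by rewrite (_ : (if _ then _ else _) = dist phi n.+1 p.1.2 (fproj (fun _ => A)) p.1.1)
    -?univ_phi //; case: ifP.
Qed.

End Uniqueness.

Theorem proposition5p9 (R : realType) (T : leftLinearTheory) (n : nat)
    (phi' : distributor R T n.-1) :
  weakly_bilinear R T ->
  (forall A B : T, serre_cofibrant R (mapsp A B)) ->
  (1 <= n)%N ->
  good phi' ->
  (exists phi : distributor R T n, good phi /\ based_on phi phi') /\
  (forall phi psi : distributor R T n,
     good phi -> based_on phi phi' -> good psi -> based_on psi phi' ->
     forall X A B : T,
       homotopic_rel R (@top_boundary R T n X A B)
         (@top_map R T n X A B phi) (@top_map R T n X A B psi)).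
Proof.
case: n phi' => // n phi' bil cof _ phi'_good; split.
  exists (extension bil cof phi'_good); split; first exact: extension_good.
  exact: extension_based_on.
move=> phi psi gphi bphi gpsi bpsi X A B.
exact: (@good_distributors_homotopic R T n phi' phi psi).
Qed.
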